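(* Let $N\ge 2$, $s\in(0,1)$, let $\Omega\subset\mathbb{R}^N$ be a smooth bounded domain, and let $\frac{2}{2-s}<p<\infty$. Then there exist $\delta>0$, $C>0$ and $0<\beta_0<\frac{sp}{p-1}<\infty$ such that for all $\beta\in(0,\beta_0)$ the barrier function $\xi$ defined in the context satisfies $$-(-\Delta)_p^s\xi(x)\le -C\,d(x)^{\beta(p-1)-sp}\qquad\text{in }\Omega_\delta .$$
   Context: Up to a normalization constant, the fractional $p$-Laplacian is $(-\Delta)_p^s u(x)=2\,\mathrm{P.V.}\int_{\mathbb{R}^N}\frac{|u(x)-u(y)|^{p-2}(u(x)-u(y))}{|x-y|^{N+sp}}\,dy$. Let $d(x)=\mathrm{dist}(x,\partial\Omega)$ for $x\in\Omega$ and $\Omega_\delta=\{x\in\Omega: d(x)<\delta\}$, with $\delta>0$ small such that $d$ is well defined and $C^2$ in $\Omega_\delta$. The barrier function is $$\xi(x)=\begin{cases} d^\beta(x) & \text{if } x\in\Omega_\delta,\\ r(x) & \text{if } x\in\Omega\setminus\Omega_\delta,\\ 0 & \text{if } x\in\Omega^c=\mathbb{R}^N\setminus\Omega,\end{cases}$$ for $\beta>0$ and a function $r$ such that $\xi$ is positive and $C^2$ in $\Omega$, with $r(x)\ge d^\beta(x)$ for $x\in\Omega\setminus\Omega_\delta$.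
   Formalization: The function r is required to satisfy r ≤ M off the collar for a prefixed arbitrary M, on which δ, C, β₀ may depend; and ξ is defined with a given collar width δ₀ while the estimate holds in Ω_δ for some δ ≤ δ₀; with r unrestricted the claim fails. *)

(* Defs.v *)
From HB Require Import structures.
From mathcomp Require Import all_boot all_order all_algebra.
From mathcomp Require Import all_classical all_reals all_analysis.

Set Implicit Arguments.
Unset Strict Implicit.
Unset Printing Implicit Defensive.
Import Order.TTheory GRing.Theory Num.Theory.
Import numFieldNormedType.Exports.

Local Open Scope classical_set_scope.
Local Open Scope ring_scope.

Definition rV_display : measure_display. Proof. exact. Qed.

Section rV_measurable.
Context {R : realType} (n : nat).

(* The sigma-algebra on R^n generated by the coordinates, i.e. the Borel sets *)
Let coors (i : 'I_n) (x : 'rV[R]_n) : measurableTypeR R := x ord0 i.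

Let rV_set0 : g_sigma_preimage coors set0.
Proof. exact: sigma_algebra0. Qed.

Let rV_setC A : g_sigma_preimage coors A -> g_sigma_preimage coors (~` A).
Proof. exact: sigma_algebraC. Qed.

Let rV_bigcup (F : (set 'rV[R]_n)^nat) :
  (forall i, g_sigma_preimage coors (F i)) -> g_sigma_preimage coors (\bigcup_i F i).
Proof. exact: sigma_algebra_bigcup. Qed.

HB.instance Definition _ := @isMeasurable.Build rV_display
  'rV[R]_n (g_sigma_preimage coors) rV_set0 rV_setC rV_bigcup.

End rV_measurable.

Lemma measurable_coord (R : realType) n (i : 'I_n) :
  measurable_fun [set: 'rV[R]_n] (fun x : 'rV[R]_n => x ord0 i : measurableTypeR R).
Proof.
move=> _ Y mY; rewrite setTI; apply: sub_sigma_algebra => /=.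
rewrite -bigcup_seq/=; exists i => /=; first by rewrite mem_index_enum.
by exists Y => //; rewrite setTI.
Qed.

Lemma measurable_fun_rV d (T : measurableType d) (R : realType) n
    (f : T -> 'rV[R]_n) :
  (forall i, measurable_fun [set: T] (fun t => f t ord0 i : measurableTypeR R)) ->
  measurable_fun [set: T] f.
Proof.
move=> mf _ Y mY; rewrite setTI.
suff : (@measurable _ 'rV[R]_n) `<=` [set A | measurable (f @^-1` A)] by exact.
apply: smallest_sub => /=.
  split => /=; first by rewrite preimage_set0.
  - by move=> A mA; rewrite setTD preimage_setC; exact: measurableC.
  - by move=> F mF; rewrite preimage_bigcup; exact: bigcup_measurable.
move=> A; rewrite -bigcup_seq => -[i _ [B mB <-]] /=.
by rewrite setTI; have := mf i measurableT B mB; rewrite setTI.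
Qed.

Section lebesgue_rV.
Context {R : realType}.
Local Notation rV n := 'rV[R]_n.

Definition rV_cons n (p : measurableTypeR R * rV n) : rV n.+1 :=
  row_mx (\row_(_ < 1) p.1) p.2.

Definition rV_uncons n (x : rV n.+1) : measurableTypeR R * rV n :=
  (x ord0 ord0, \row_i x ord0 (lift ord0 i)).

Lemma rV_consE0 n p : @rV_cons n p ord0 ord0 = p.1.
Proof. by rewrite mxE; case: splitP => // j _; rewrite mxE. Qed.

Lemma rV_consES n p i : @rV_cons n p ord0 (lift ord0 i) = p.2 ord0 i.
Proof.
rewrite mxE; case: splitP => [[[]]//|j].
by rewrite [LHS]lift0 add1n => -[ij]; congr (p.2 _ _); exact/val_inj.
Qed.

Lemma rV_consK n : cancel (@rV_cons n) (@rV_uncons n).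
Proof.
move=> p; rewrite /rV_uncons rV_consE0 [RHS]surjective_pairing; congr (_, _).
by apply/rowP => i; rewrite mxE rV_consES.
Qed.

Lemma rV_unconsK n : cancel (@rV_uncons n) (@rV_cons n).
Proof.
move=> x; apply/rowP => i.
by case: (unliftP ord0 i) => [j|] ->; rewrite ?rV_consES ?rV_consE0 ?mxE.
Qed.

Lemma measurable_rV_cons n : measurable_fun setT (@rV_cons n).
Proof.
apply: measurable_fun_rV => i; case: (unliftP ord0 i) => [j|] -> /=.
  under eq_fun do rewrite rV_consES.
  exact: (measurableT_comp (measurable_coord j) measurable_snd).
under eq_fun do rewrite rV_consE0.
exact: measurable_fst.
Qed.

Lemma measurable_rV_uncons n : measurable_fun setT (@rV_uncons n).
Proof.
apply: measurable_fun_pair => /=; first exact: measurable_coord.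
apply: measurable_fun_rV => i /=; under eq_fun do rewrite mxE.
exact: measurable_coord.
Qed.

Local Open Scope ereal_scope.

Section step.
Variables (leb : {sigma_finite_measure set (measurableTypeR R) -> \bar R}).
Variables (n : nat) (mu : {sigma_finite_measure set (rV n) -> \bar R}).

Let step := pushforward (leb \x mu) (@rV_cons n).

Let step_measure : {measure set (rV n.+1) -> \bar R} :=
  measure_function_pushforward__canonical__measure_function_Measure
    (leb \x mu) (@measurable_rV_cons n).

HB.instance Definition _ := Measure.copy step step_measure.

Let step_sigma_finite : sigma_finite setT step.
Proof.
have /sigma_finiteP[F [F_T ndF F_oo]] := sigma_finiteT leb.
have /sigma_finiteP[G [G_T ndG G_oo]] := sigma_finiteT mu.
exists (fun k => @rV_uncons n @^-1` (F k `*` G k)).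
  rewrite -preimage_bigcup -[LHS](preimage_setT (@rV_uncons n)).
  congr (_ @^-1` _); rewrite -setXTT F_T G_T; apply/seteqP; split => -[x v].
    move=> [/= [a _ Fx] [b _ Gv]]; exists (maxn a b) => //; split.
    - by move: x Fx; exact/subsetPset/ndF/leq_maxl.
    - by move: v Gv; exact/subsetPset/ndG/leq_maxr.
  by move=> [k _ []/= ? ?]; split; exists k.
move=> k; have [mF Fk] := F_oo k; have [mG Gk] := G_oo k; split.
  rewrite -[X in measurable X]setTI; apply: measurable_rV_uncons => //.
  exact: measurableX.
rewrite /step /pushforward -comp_preimage (_ : _ \o _ = id); last first.
  by apply/funext => p /=; rewrite rV_consK.
by rewrite preimage_id product_measure1E// lte_mul_pinfty// ge0_fin_numE.
Qed.

HB.instance Definition _ :=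
  Measure_isSigmaFinite.Build _ _ _ step step_sigma_finite.

Lemma lebesgue_rV_step :
  exists mu' : {sigma_finite_measure set (rV n.+1) -> \bar R},
    pushforward (leb \x mu) (@rV_cons n) = mu' :> (_ -> _).
Proof. by exists step. Qed.

End step.

(* R^0 has mass 1, and R^(n+1) carries the product of the Lebesgue measures of
   R and R^n *)
Fixpoint lebesgue_rV n : set (rV n) -> \bar R :=
  match n with
  | 0 => dirac (0%R : rV 0)
  | n'.+1 => pushforward (@lebesgue_measure R \x @lebesgue_rV n') (@rV_cons n')
  end.

Lemma lebesgue_rV_sigma_finite_measure n :
  exists mu : {sigma_finite_measure set (rV n) -> \bar R},
    @lebesgue_rV n = mu :> (_ -> _).
Proof.
elim: n => [|n [mu ih]] /=; first by exists (dirac (0%R : rV 0)).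
by rewrite ih; exact: (lebesgue_rV_step lebesgue_measure).
Qed.

Let lebesgue_rV0 n : @lebesgue_rV n set0 = 0.
Proof.
by have [mu ->] := lebesgue_rV_sigma_finite_measure n; rewrite measure0.
Qed.

Let lebesgue_rV_ge0 n A : 0 <= @lebesgue_rV n A.
Proof. by have [mu ->] := lebesgue_rV_sigma_finite_measure n. Qed.

Let lebesgue_rV_sigma_additive n : semi_sigma_additive (@lebesgue_rV n).
Proof.
have [mu ->] := lebesgue_rV_sigma_finite_measure n.
exact: measure_semi_sigma_additive.
Qed.

HB.instance Definition _ n := isMeasure.Build _ _ _ (@lebesgue_rV n)
  (@lebesgue_rV0 n) (@lebesgue_rV_ge0 n) (@lebesgue_rV_sigma_additive n).

Let lebesgue_rV_sigma_finite n : sigma_finite setT (@lebesgue_rV n).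
Proof.
have [mu ->] := lebesgue_rV_sigma_finite_measure n.
exact: sigma_finiteT.
Qed.

HB.instance Definition _ n := Measure_isSigmaFinite.Build _ _ _
  (@lebesgue_rV n) (@lebesgue_rV_sigma_finite n).

Lemma lebesgue_rV_box n (a b : 'I_n -> R) : (forall i, a i <= b i)%R ->
  @lebesgue_rV n [set x | forall i, x ord0 i \in `]a i, b i]] =
  (\prod_(i < n) (b i - a i))%:E.
Proof.
elim: n => [|n ih] in a b *.
  by move=> _; rewrite big_ord0 /= diracE mem_set// => -[].
move=> ab; rewrite big_ord_recl EFinM /= /pushforward.
have boxE : @rV_cons n @^-1` [set x | forall i, x ord0 i \in `]a i, b i]] =
    [set` `]a ord0, b ord0] ] `*`
    [set x : rV n | forall i, x ord0 i \in `]a (lift ord0 i), b (lift ord0 i)]].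
  apply/seteqP; split => -[x v] /= => [xv|[xv vv] i].
    split => [|i]; first by have := xv ord0; rewrite rV_consE0.
    by have := xv (lift ord0 i); rewrite rV_consES.
  by case: (unliftP ord0 i) => [j|] ->; rewrite ?rV_consE0 ?rV_consES.
have mB : measurable [set x : rV n | forall i,
    x ord0 i \in `]a (lift ord0 i), b (lift ord0 i)]].
  rewrite (_ : mkset _ = \bigcap_(i in [set: 'I_n])
    ((fun x : rV n => x ord0 i : measurableTypeR R) @^-1`
      [set` `]a (lift ord0 i), b (lift ord0 i)]])).
    apply: fin_bigcap_measurable => // i _.
    by rewrite -[X in measurable X]setTI; exact: measurable_coord.
  by apply/seteqP; split => x /= xi i; [move=> _|]; exact: xi.
rewrite -[LHS]/((_ \x _) (_ @^-1` _)) boxE product_measure1E//=.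
rewrite lebesgue_measure_itv/= lte_fin ih//.
have [_|] := ltP (a ord0) (b ord0); first by rewrite EFinB.
by move=> ba; rewrite (le_anti (introT andP (conj (ab ord0) ba))) subrr mul0e.
Qed.

End lebesgue_rV.

Section domains.
Context {R : realType}.

(* [`|x|] on ['rV[R]_n] is the sup norm, so the Euclidean norm is needed; both
   induce the same topology and the same bounded sets. *)
Definition enorm n (x : 'rV[R]_n) : R := Num.sqrt (\sum_(i < n) x ord0 i ^+ 2).

(* [C^k] on an open set [U]: all iterated partial derivatives of order at most
   [k] exist and are continuous at every point of [U]. *)
Fixpoint Ck n (k : nat) (U : set 'rV[R]_n) (f : 'rV[R]_n -> R) : Prop :=
  (forall x, U x -> {for x, continuous f}) /\
  if k is k'.+1 then
    forall i : 'I_n, (forall x, U x -> derivable f x (delta_mx ord0 i)) /\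
      Ck k' U (fun x => 'D_(delta_mx ord0 i) f x)
  else True.

Definition smooth n (f : 'rV[R]_n -> R) : Prop := forall k, Ck k setT f.

Definition boundary n (A : set 'rV[R]_n) : set 'rV[R]_n :=
  closure A `\` interior A.

(* Near each boundary point, [A] is the region strictly on one side of the graph
   of a smooth function of all the coordinates but one ([col' i x] drops the
   [i]-th coordinate, [b] selects the side). *)
Definition smooth_boundary n (A : set 'rV[R]_n) : Prop :=
  forall z, boundary A z ->
    exists (rho : R) (i : 'I_n) (b : bool) (g : 'rV[R]_n.-1 -> R),
      [/\ 0 < rho, smooth g &
          forall x, enorm (x - z) < rho ->
            (A x <-> g (col' i x) < (-1) ^+ b * x ord0 i)].

Definition smooth_bounded_domain n (A : set 'rV[R]_n) : Prop :=
  [/\ A !=set0, open A, connected A, bounded_set A & smooth_boundary A].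

(* [d(x) = dist(x, \partial A)] *)
Definition bdist n (A : set 'rV[R]_n) (x : 'rV[R]_n) : R :=
  inf [set enorm (x - z) | z in boundary A].

Definition collar n (A : set 'rV[R]_n) (delta : R) : set 'rV[R]_n :=
  [set x | A x /\ bdist A x < delta].

Definition barrier n (A : set 'rV[R]_n) (delta beta : R) (r : 'rV[R]_n -> R)
    (x : 'rV[R]_n) : R :=
  if x \in collar A delta then bdist A x `^ beta
  else if x \in A then r x else 0.

Definition barrier_ext n (A : set 'rV[R]_n) (delta beta : R)
    (r : 'rV[R]_n -> R) : Prop :=
  [/\ forall x, A x -> 0 < barrier A delta beta r x,
      Ck 2 A (barrier A delta beta r) &
      forall x, (A `\` collar A delta) x -> bdist A x `^ beta <= r x].

(* Narrowing the collar: a barrier function for [delta0] is also one for every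
   smaller [delta]. *)
Lemma barrierW n (A : set 'rV[R]_n) (delta delta0 beta : R) r :
  delta <= delta0 ->
  barrier A delta beta (barrier A delta0 beta r) = barrier A delta0 beta r.
Proof.
move=> dd0; apply/funext => x; rewrite /barrier.
have [/set_mem [Ax dx]|_] := boolP (x \in collar A delta).
  by rewrite mem_set//; split => //; exact: lt_le_trans dd0.
have [//|nx] := boolP (x \in A).
by rewrite memNset// => -[/mem_set]; rewrite (negPf nx).
Qed.

Lemma barrier_extW n (A : set 'rV[R]_n) (delta delta0 beta : R) r :
  delta <= delta0 -> barrier_ext A delta0 beta r ->
  barrier_ext A delta beta (barrier A delta0 beta r).
Proof.
move=> dd0 [pos c2 rge]; split; rewrite ?barrierW// => x [Ax _].
rewrite /barrier; case: ifPn => [//|nx]; rewrite mem_set//; apply: rge.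
by split => // /mem_set; rewrite (negPf nx).
Qed.

End domains.

Section fractional_p_laplacian.
Context {R : realType}.
Local Open Scope ereal_scope.

(* The integral over [R^n] minus the ball of radius [eps] around [x] *)
Definition frac_plap_trunc n (s p : R) (u : 'rV[R]_n -> R) (x : 'rV[R]_n)
    (eps : R) : \bar R :=
  \int[@lebesgue_rV R n]_(y in [set y | (eps <= enorm (x - y))%R])
    ((`|u x - u y| `^ (p - 2) * (u x - u y)) /
      enorm (x - y) `^ (n%:R + s * p))%R%:E.

(* The principal value defining [(-\Delta)_p^s u(x)] exists, is finite and
   equals [L] *)
Definition is_frac_plap n (s p : R) (u : 'rV[R]_n -> R) (x : 'rV[R]_n)
    (L : R) : Prop :=
  2%:E * frac_plap_trunc s p u x eps @[eps --> 0%R^'+] --> L%:E.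

End fractional_p_laplacian.

(* Main.v *)
Require Import Defs.
From mathcomp Require Import all_boot all_order all_algebra.
From mathcomp Require Import all_classical all_reals all_analysis.
From mathcomp Require Import measurable_realfun.
From mathcomp Require Import ring lra.

(** As [beta] tends to [0] the barrier tends to the indicator of [Omega], for
    which the operator at [x] is the integral of [2 |x - y|^(- N - s p)] over
    the complement of [Omega], hence at least of order [d(x)^(- s p)]: the
    smooth boundary leaves a cube of size comparable to [d(x)] outside [Omega]
    at distance comparable to [d(x)].  All the other contributions are absorbed
    when [beta] and [delta] are small.

    On the ball of radius [d(x) / 2], pairing [y] with [2 x - y] reduces the
    integrand to a second difference of [d^beta].  Since [d] is an infimum of
    distances to points, this difference is at most
    [beta d(x)^beta (|x - y| / d(x))^2], whatever the curvature of the boundary,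
    so the contribution is [O(beta^(p - 1)) d(x)^(beta (p - 1) - s p)]; the
    convergence of the integral is where [p > 2 / (2 - s)] is needed.  Away from
    that ball, [(1 + t)^beta - 1 <= (beta / b1) (3 t)^b1], for a fixed [b1] with
    [b1 (p - 1) < s p], gives the same order for the points of the collar, and
    the points beyond the collar contribute [O(d(x)^(b1 (p - 1) - s p))], which
    is negligible for small [delta] when [beta <= b1 / 2]. *)

Set Implicit Arguments.
Unset Strict Implicit.
Unset Printing Implicit Defensive.
Import Order.TTheory GRing.Theory Num.Theory.
Import numFieldNormedType.Exports.

Local Open Scope classical_set_scope.
Local Open Scope ring_scope.

(** * Real powers and signed powers *)

(** The obstacle is uniformity: [delta] and [C] are fixed before [beta], [r] and [x]. For this
    reason the bound [M] for [r] beyond the collar is given beforehand, and the barrier keeps the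
    width [delta0] while [x] ranges over a collar at most half as wide, so that [x] stays at
    distance at least [delta0 / 2] from the core. The C^2 regularity of the barrier yields constants
    that depend on [x] and [r]; they only serve to show that the principal value exists. The
    quantitative estimate is one-sided and has constants of its own: a lower bound for the operator
    asks for an upper bound on the second difference, and that is what an infimum of distances
    provides. The exponent [b1] separates two roles of [beta]: the decay of the tail is measured by
    the fixed number [s p - b1 (p - 1) > 0], so the tail constants stay put while [beta] tends to
    0. *)

Section powR_inequalities.
Context {R : realType}.
Implicit Types a b e q x : R.

(** Young's inequality for the product of [x^a] and 1, with conjugate exponents [1 / a] and
    [1 / (1 - a)]; the degenerate values of [a] are treated apart. *)
Lemma powR_le_bernoulli a x : 0 <= a <= 1 -> 0 <= x ->
  x `^ a <= 1 + a * (x - 1).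
Proof.
move=> /andP[]; rewrite le_eqVlt => /predU1P[<- _ _|a0].
  by rewrite powRr0 mul0r addr0.
rewrite le_eqVlt => /predU1P[->|a1] x0; first by rewrite powRr1//; lra.
have := @conjugate_powR R (x `^ a) 1 a^-1 (1 - a)^-1.
rewrite powR_ge0 ler01 !invr_gt0 subr_gt0 a0 a1 !invrK subrKC mulr1.
move=> /(_ isT isT isT isT erefl); rewrite -powRrM mulfV ?gt_eqF// powRr1//.
by rewrite powR1; lra.
Qed.

(** The concave case with exponent [1 / q], applied to [1 + q (x - 1)] and raised to the power
    [q]. *)
Lemma powR_ge_bernoulli q x : 1 <= q -> 0 <= x ->
  1 + q * (x - 1) <= x `^ q.
Proof.
move=> q1 x0; have q0 : 0 < q by lra.
have [h|h] := leP (1 + q * (x - 1)) 0; first exact: le_trans (powR_ge0 _ _).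
have := @powR_le_bernoulli q^-1 (1 + q * (x - 1)).
rewrite invr_ge0 (ltW q0) invf_le1// q1 (ltW h) => /(_ isT isT).
rewrite addrAC subrr add0r mulKf ?gt_eqF// subrKC => le1.
have := @ge0_ler_powR R q (ltW q0) _ _ (powR_ge0 _ _) x0 le1.
by rewrite -powRrM mulVf ?gt_eqF// powRr1// ltW.
Qed.

(** By homogeneity, after division by [(b + e)^q], this is the Bernoulli inequality at
    [b / (b + e)]. *)
Lemma powRB_le q b e : 1 <= q -> 0 <= b -> 0 <= e ->
  (b + e) `^ q - b `^ q <= q * e * (b + e) `^ (q - 1).
Proof.
move=> q1 b0 e0; have [be|be] := leP (b + e) 0.
  have -> : b = 0 by lra.
  have -> : e = 0 by lra.
  by rewrite addr0 subrr mulr0 mul0r.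
have := @powR_ge_bernoulli q (b / (b + e)) q1.
rewrite divr_ge0 ?(ltW be)// => /(_ isT) h.
have E : b `^ q = (b + e) `^ q * (b / (b + e)) `^ q.
  by rewrite -powRM ?divr_ge0 ?(ltW be)// mulrCA mulfV ?mulr1// gt_eqF.
rewrite E; have E2 : q * e * (b + e) `^ (q - 1) =
    (b + e) `^ q * (- (q * (b / (b + e) - 1))).
  rewrite -(@mulr_powRB1 R (b + e) q); [|lra..].
  by field; lra.
rewrite E2 -{1}[(b + e) `^ q]mulr1 -mulrBr ler_wpM2l ?powR_ge0//; lra.
Qed.

(** As [q - 1 <= 0], every [u] in [[0, b + e]] satisfies [u (b + e)^(q - 1) <= u^q]; the cases
    [u = b] and [u = e] are added. *)
Lemma powR_subadditive q b e : 0 < q <= 1 -> 0 <= b -> 0 <= e ->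
  (b + e) `^ q <= b `^ q + e `^ q.
Proof.
move=> /andP[q0 q1] b0 e0; have [be|be] := leP (b + e) 0.
  have -> : b = 0 by lra.
  have -> : e = 0 by lra.
  by rewrite addr0 lerDl powR_ge0.
have step u : 0 <= u <= b + e -> u * (b + e) `^ (q - 1) <= u `^ q.
  move=> /andP[]; rewrite le_eqVlt => /predU1P[<-|u0 ube].
    by rewrite mul0r powR_ge0.
  rewrite -(@mulr_powRB1 R u q) ?(ltW u0)// ler_wpM2l ?(ltW u0)//.
  rewrite -(opprB 1 q) !powRN lef_pV2 ?posrE ?powR_gt0//.
  by rewrite ge0_ler_powR ?nnegrE; lra.
have h1 := step b; have h2 := step e.
rewrite -(@mulr_powRB1 R (b + e) q) ?(ltW be)// mulrDl lerD ?h1 ?h2//; lra.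
Qed.

(** The odd extension of the power; for [q = p - 1] it is the nonlinearity of the operator. *)
Definition spowR q a : R := Num.sg a * `|a| `^ q.

Lemma spowRN q a : spowR q (- a) = - spowR q a.
Proof. by rewrite /spowR sgrN normrN mulNr. Qed.

Lemma spowR_ge0E q a : 0 < q -> 0 <= a -> spowR q a = a `^ q.
Proof.
move=> q0; rewrite le_eqVlt => /predU1P[<-|a0].
  by rewrite /spowR sgr0 mul0r powR0// gt_eqF.
by rewrite /spowR gtr0_sg// mul1r gtr0_norm.
Qed.

Lemma spowR_le0E q a : 0 < q -> a <= 0 -> spowR q a = - (- a) `^ q.
Proof.
by move=> q0 a0; rewrite -{1}[a]opprK spowRN spowR_ge0E// oppr_ge0.
Qed.

Lemma ler_spowR q : 0 < q -> {homo spowR q : a b / a <= b}.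
Proof.
move=> q0 a b ab; have [a0|a0] := leP 0 a.
  by rewrite !spowR_ge0E ?ge0_ler_powR ?nnegrE ?(ltW q0)//; lra.
have [b0|b0] := leP 0 b.
  rewrite (spowR_le0E _ (ltW a0))// spowR_ge0E//.
  by rewrite (@le_trans _ _ 0) ?powR_ge0// oppr_le0 powR_ge0.
rewrite !spowR_le0E ?(ltW a0) ?(ltW b0)// lerN2.
by rewrite ge0_ler_powR ?nnegrE ?(ltW q0)//; lra.
Qed.

Lemma norm_spowR q a : 0 < q -> `|spowR q a| = `|a| `^ q.
Proof.
move=> q0; have [a0|a0] := leP 0 a.
  by rewrite spowR_ge0E// !ger0_norm ?powR_ge0.
by rewrite spowR_le0E ?(ltW a0)// normrN ger0_norm ?powR_ge0// ltr0_norm.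
Qed.

Lemma spowRE p a : p - 1 != 0 -> `|a| `^ (p - 2) * a = spowR (p - 1) a.
Proof.
move=> p1; have [->|a0] := eqVneq a 0; first by rewrite mulr0 /spowR sgr0 mul0r.
rewrite {2}[a]numEsg mulrCA; congr (_ * _).
have {2}-> : `|a| = `|a| `^ 1 by rewrite powRr1.
by rewrite -powRD ?normr_eq0 ?a0 ?implybT//; congr powR; ring.
Qed.

(** On one side of 0, oddness reduces the increment to subadditivity. An increment across 0 splits
    there into two pieces, whence the factor 2. *)
Lemma spowRD_le1 q b e : 0 < q <= 1 -> 0 <= e ->
  spowR q (b + e) - spowR q b <= 2 * e `^ q.
Proof.
move=> q01 e0; have q0 : 0 < q by lra.
have h c : 0 <= c -> spowR q (c + e) - spowR q c <= e `^ q.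
  move=> c0; rewrite !spowR_ge0E//; [|lra].
  by have := @powR_subadditive q c e q01 c0 e0; lra.
have eq0 := powR_ge0 e q.
have [b0|b0] := leP 0 b; first by have := h b b0; lra.
have [be0|be0] := leP (b + e) 0.
  have := h (- (b + e)); rewrite opprD subrK -opprD !spowRN; lra.
have h0 : spowR q e <= e `^ q by rewrite spowR_ge0E.
have := @ler_spowR q q0 (b + e) e.
have := @ler_spowR q q0 (- e) b; rewrite spowRN; lra.
Qed.

(** The same splitting at 0, with the convexity bound in place of subadditivity. *)
Lemma spowRD_ge1 q b e B : 1 <= q -> 0 <= e -> `|b| <= B ->
  spowR q (b + e) - spowR q b <= 2 * (q * e * (B + e) `^ (q - 1)).
Proof.
move=> q1 e0 bB; have q0 : 0 < q by lra.
have B0 : 0 <= B by exact: le_trans bB.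
have h c : 0 <= c <= B ->
    spowR q (c + e) - spowR q c <= q * e * (B + e) `^ (q - 1).
  move=> /andP[c0 cB]; rewrite !spowR_ge0E//; [|lra].
  apply: le_trans (powRB_le _ _ _) _ => //; rewrite ler_wpM2l ?mulr_ge0//.
    lra.
  by rewrite ge0_ler_powR ?nnegrE; lra.
have eq0 : 0 <= q * e * (B + e) `^ (q - 1).
  by rewrite !mulr_ge0 ?powR_ge0// ltW.
move: bB; rewrite ler_norml => /andP[Bb bB].
have [b0|b0] := leP 0 b; first by have := h b; rewrite b0 bB => /(_ isT); lra.
have [be0|be0] := leP (b + e) 0.
  have := h (- (b + e)); rewrite opprD subrK -opprD !spowRN; lra.
have h0 : spowR q e <= q * e * (B + e) `^ (q - 1).
  by have := h 0; rewrite lexx B0 add0r {2}/spowR sgr0 mul0r subr0; apply.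
have := @ler_spowR q q0 (b + e) e.
have := @ler_spowR q q0 (- e) b; rewrite spowRN; lra.
Qed.

(* The exponent [kappa] is [2 (p - 1)] or [p]; it exceeds [s p] exactly when [p]
   is above the threshold [2 / (2 - s)]. *)
Lemma spowR_second_difference (s p : R) : 0 < s < 1 -> 2 / (2 - s) < p ->
  exists kappa K : R, [/\ s * p < kappa, 0 <= K &
    forall c t a b, 0 <= c -> 0 <= t <= 1 -> `|b| <= 2 * c * t ->
      - (c * t ^+ 2) <= a + b ->
      - (K * c `^ (p - 1) * t `^ kappa) <=
        spowR (p - 1) a + spowR (p - 1) b].
Proof.
move=> s01; rewrite ltr_pdivrMr; last lra.
move=> ps; have p1 : 1 < p by nra.
(* The signed power is increasing, so [a] may be replaced by [- (b + c t^2)]: only an increment of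
   length [c t^2] at [b] is left. *)
have red c t a b : 0 <= c -> - (c * t ^+ 2) <= a + b ->
    - (spowR (p - 1) (b + c * t ^+ 2) - spowR (p - 1) b) <=
    spowR (p - 1) a + spowR (p - 1) b.
  move=> c0 ab; have := @ler_spowR (p - 1) _ (- (b + c * t ^+ 2)) a.
  by rewrite spowRN; lra.
have [p2|p2] := leP p 2.
  exists (2 * (p - 1)), 2; split => //; first nra.
  move=> c t a b c0 t01 bct /(red _ _ _ _ c0); apply: le_trans.
  rewrite lerN2; apply: le_trans (spowRD_le1 _ _ _) _.
  - by apply/andP; split; lra.
  - by rewrite mulr_ge0 ?exprn_ge0//; lra.
  rewrite powRM ?exprn_ge0//; last lra.
  by rewrite -powR_mulrn -?powRrM ?mulrA//; lra.
(* The 3 comes from [2 c t + c t^2 <= 3 c t], valid as [t <= 1]. *)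
exists p, (2 * ((p - 1) * 3 `^ (p - 2))); split => //; first nra.
  by rewrite !mulr_ge0 ?powR_ge0//; lra.
move=> c t a b c0 t01 bct /(red _ _ _ _ c0); apply: le_trans.
have t0 : 0 <= t by lra.
have ct2 : c * t ^+ 2 <= c * t by rewrite ler_wpM2l//; nra.
rewrite lerN2; apply: le_trans (spowRD_ge1 _ _ bct) _.
- lra.
- by rewrite mulr_ge0 ?exprn_ge0//; lra.
rewrite -!mulrA ler_wpM2l// ler_wpM2l//; first lra.
have -> : p - 1 - 1 = p - 2 by ring.
rewrite -(@mulr_powRB1 _ c (p - 1))//; last lra.
have -> : p - 1 - 1 = p - 2 by ring.
have -> : t `^ p = t ^+ 2 * t `^ (p - 2).
  by rewrite expr2 -(@mulr_powRB1 _ t p)// -?(@mulr_powRB1 _ t (p - 1))//;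
    rewrite ?mulrA; [congr (_ * _ `^ _); ring|lra..].
have -> : 3 `^ (p - 2) * (c * c `^ (p - 2) * (t ^+ 2 * t `^ (p - 2))) =
   c * (t ^+ 2 * (3 * (c * t)) `^ (p - 2)).
  by rewrite !powRM ?mulr_ge0//; ring.
rewrite [t * (t * _)]mulrA -expr2.
rewrite ler_wpM2l// ler_wpM2l ?exprn_ge0// ge0_ler_powR ?nnegrE//; try lra.
  by rewrite addr_ge0 ?mulr_ge0 ?exprn_ge0.
  by rewrite !mulr_ge0.
Qed.

End powR_inequalities.

(** * The Euclidean norm *)

Section euclidean_norm.
Context {R : realType}.

Section fixed_dimension.
Variable n : nat.
Implicit Types (x y w h : 'rV[R]_n) (a : R).

Lemma enorm_ge0 x : 0 <= enorm x.
Proof. exact: sqrtr_ge0. Qed.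

Lemma sqr_enorm x : enorm x ^+ 2 = \sum_(i < n) x ord0 i ^+ 2.
Proof. by rewrite sqr_sqrtr// sumr_ge0// => i _; rewrite sqr_ge0. Qed.

Lemma enormN x : enorm (- x) = enorm x.
Proof.
by rewrite /enorm; congr Num.sqrt; apply: eq_bigr => i _; rewrite mxE sqrrN.
Qed.

Lemma enormB x y : enorm (x - y) = enorm (y - x).
Proof. by rewrite -enormN opprB. Qed.

Lemma enormZ a x : enorm (a *: x) = `|a| * enorm x.
Proof.
apply/eqP; rewrite -(@eqrXn2 _ 2)// ?mulr_ge0 ?enorm_ge0//.
rewrite exprMn !sqr_enorm -normrX ger0_norm ?sqr_ge0// mulr_sumr.
by apply/eqP/eq_bigr => i _; rewrite mxE exprMn.
Qed.

(** The squared norm of [x - a y] is nonnegative for every [a]. The choice [a = |x| / |y|] gives the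
    bound; when a norm vanishes, another [a] contradicts a positive sum. *)
Lemma cauchy_schwarz x y :
  \sum_(i < n) x ord0 i * y ord0 i <= enorm x * enorm y.
Proof.
set S := \sum_(i < n) _.
have h a : 0 <= enorm x ^+ 2 - 2 * a * S + a ^+ 2 * enorm y ^+ 2.
  rewrite !sqr_enorm !mulr_sumr -sumrN -!big_split/= sumr_ge0// => i _.
  by have := sqr_ge0 (x ord0 i - a * y ord0 i); lra.
have x0 := enorm_ge0 x; have y0 := enorm_ge0 y.
move: h x0 y0; move: (enorm x) (enorm y) => u v h u0.
rewrite le_eqVlt => /predU1P[v0|v0].
  move: h; rewrite -v0 => h; rewrite mulr0 leNgt; apply/negP => S0.
  have := h ((u ^+ 2 + 1) / (2 * S)).
  have -> : 2 * ((u ^+ 2 + 1) / (2 * S)) * S = u ^+ 2 + 1 by field; lra.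
  by rewrite expr0n/= mulr0; lra.
rewrite le_eqVlt in u0; case/predU1P: u0 => [u0|u0].
  rewrite -u0 mul0r leNgt; apply/negP => S0; have := h (S / v ^+ 2).
  have -> : (S / v ^+ 2) ^+ 2 * v ^+ 2 = S / v ^+ 2 * S by field; lra.
  rewrite -u0 expr0n/=; have : 0 < S / v ^+ 2 * S.
    by rewrite mulr_gt0 ?divr_gt0 ?exprn_gt0.
  by lra.
have := h (u / v); rewrite -exprMn divfK ?gt_eqF// => {}h.
have : 2 * (u / v) * S <= 2 * u ^+ 2 by lra.
have -> : 2 * (u / v) * S = 2 * u * (S / v) by field; rewrite gt_eqF.
have -> : 2 * u ^+ 2 = 2 * u * u by ring.
rewrite ler_pM2l ?mulr_gt0//.
by rewrite ler_pdivrMr.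
Qed.

Lemma ler_enormD x y : enorm (x + y) <= enorm x + enorm y.
Proof.
rewrite -(@ler_sqr R) ?nnegrE ?addr_ge0 ?enorm_ge0//.
rewrite sqrrD !sqr_enorm; have := cauchy_schwarz x y.
set S := \sum_(i < n) _ => hS.
have -> : \sum_(i < n) (x + y) ord0 i ^+ 2 =
    \sum_(i < n) x ord0 i ^+ 2 + S *+ 2 + \sum_(i < n) y ord0 i ^+ 2.
  rewrite -sumrMnl -!big_split/=; apply: eq_bigr => i _.
  by rewrite mxE sqrrD.
by rewrite lerD2r lerD2l lerMn2r.
Qed.

Lemma ler_enormB x y w : enorm (x - y) <= enorm (x - w) + enorm (w - y).
Proof. by rewrite -{1}(subrK w x) -addrA ler_enormD. Qed.

Lemma coord_le_enorm x i : `|x ord0 i| <= enorm x.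
Proof.
rewrite -(@ler_sqr R) ?nnegrE ?enorm_ge0// sqr_enorm -normrX.
rewrite ger0_norm ?sqr_ge0// (bigD1 i)//= lerDl sumr_ge0// => j _.
exact: sqr_ge0.
Qed.

Lemma enorm_le_coord x a : 0 <= a -> (forall i, `|x ord0 i| <= a) ->
  enorm x <= n%:R * a.
Proof.
move=> a0 xa; rewrite -(@ler_sqr R) ?nnegrE ?enorm_ge0 ?mulr_ge0//.
rewrite sqr_enorm exprMn (@le_trans _ _ (n%:R * a ^+ 2))//.
  have -> : n%:R * a ^+ 2 = \sum_(i < n) a ^+ 2.
    by rewrite sumr_const card_ord mulr_natl.
  apply: ler_sum => i _.
  by rewrite -[leLHS]ger0_norm ?sqr_ge0// normrX ler_sqr ?nnegrE.
rewrite ler_wpM2r ?exprn_ge0//; case: (n) => [|m]; first by rewrite expr0n.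
by rewrite expr2 ler_peMr ?ler1n ?ler0n.
Qed.

Lemma coord_le_norm x i : `|x ord0 i| <= `|x|.
Proof.
have /mapP[j Hj ->] : `|x ord0 i| \in [seq `|x k.1 k.2| | k : 'I_1 * 'I_n].
  by apply/mapP; exists (ord0, i) => //=; rewrite mem_enum.
rewrite [leRHS]/Num.norm /= mx_normrE.
by apply/bigmax_geP; right => /=; exists j.
Qed.

Lemma norm_le_coord x a : 0 <= a -> (forall i, `|x ord0 i| <= a) -> `|x| <= a.
Proof.
move=> a0 xa; rewrite [leLHS]/Num.norm /= mx_normrE.
apply/bigmax_leP; split=> //.
by move=> [i j] _ /=; rewrite ord1.
Qed.

Lemma norm_le_enorm x : `|x| <= enorm x.
Proof.
by apply: norm_le_coord => [|i]; [exact: enorm_ge0|exact: coord_le_enorm].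
Qed.

Lemma enorm_le_norm x : enorm x <= n%:R * `|x|.
Proof. by apply: enorm_le_coord => // i; exact: coord_le_norm. Qed.

Lemma enorm_eq0 x : (enorm x == 0) = (x == 0).
Proof.
apply/idP/idP => [/eqP x0|/eqP->]; last first.
  have := enorm_le_norm 0; rewrite normr0 mulr0 => h.
  by rewrite eq_le h enorm_ge0.
by rewrite -normr_le0 -x0 norm_le_enorm.
Qed.

Lemma enorm_parallelogram w h :
  enorm (w + h) ^+ 2 + enorm (w - h) ^+ 2 = 2 * (enorm w ^+ 2 + enorm h ^+ 2).
Proof.
rewrite !sqr_enorm -!big_split/= mulr_sumr; apply: eq_bigr => i _.
by rewrite !mxE; ring.
Qed.

Lemma near_norm x a : 0 < a -> \forall y \near x, `|x - y| <= a.
Proof.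
move=> a0.
have /cvgrPdist_le h : (fun y : 'rV[R]_n => y) @ x --> x by exact: cvg_id.
exact: h.
Qed.

Lemma continuous_enorm : continuous (@enorm R n).
Proof.
move=> x; apply/(@cvgrPdist_le _ _ _ (nbhs (x : 'rV[R]_n))) => e e0.
have n1 : 0 < n%:R + 1 :> R by rewrite ltr_wpDl.
near=> y; rewrite ler_norml; apply/andP.
have xy : enorm (x - y) <= e.
  apply: le_trans (enorm_le_norm _) _.
  rewrite (@le_trans _ _ ((n%:R + 1) * `|x - y|))//.
    by rewrite ler_wpM2r// lerDl.
  rewrite mulrC -ler_pdivlMr//; near: y.
  by apply: near_norm; rewrite divr_gt0.
have := ler_enormD (x - y) y; have := ler_enormD (y - x) x.
by rewrite !subrK (enormB y); split; lra.
Unshelve. all: by end_near. Qed.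

End fixed_dimension.

End euclidean_norm.

(** * Lebesgue measure on row vectors *)

Section lebesgue_rV_theory.
Context {R : realType}.

Section fixed_dimension.
Variable n : nat.
Local Notation mu := (@lebesgue_rV R n).
Implicit Types (x y c : 'rV[R]_n) (A D : set 'rV[R]_n).

Definition rect (B : 'I_n -> set (measurableTypeR R)) : set 'rV[R]_n :=
  [set x | forall i, B i (x ord0 i)].

Lemma measurable_rect (B : 'I_n -> set (measurableTypeR R)) :
  (forall i, measurable (B i)) -> measurable (rect B).
Proof.
move=> mB; rewrite (_ : rect B = \bigcap_(i in [set: 'I_n])
    ((fun x : 'rV[R]_n => x ord0 i : measurableTypeR R) @^-1` B i)).
  apply: fin_bigcap_measurable => // i _.
  by rewrite -[X in measurable X]setTI; exact: measurable_coord.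
by apply/seteqP; split => x /= xi i; [move=> _|]; exact: xi.
Qed.

(** The sigma-algebra is generated by the coordinates, so an open set is exhibited as a countable
    union: that of the cubes inside it with rational centre and half-side [1 / (m + 1)]. *)
Lemma open_measurable_rV (U : set 'rV[R]_n) : open U -> measurable U.
Proof.
move=> oU.
pose B (q : {ffun 'I_n -> rat} * nat) := rect (fun i =>
  [set` `]ratr (q.1 i) - q.2.+1%:R^-1, ratr (q.1 i) + q.2.+1%:R^-1[%R]).
have -> : U = \bigcup_(q in [set q | B q `<=` U]) B q.
  apply/seteqP; split => [x Ux|x [q qU]]; last exact: qU.
  have : nbhs x U by exact: open_nbhs_nbhs.
  move=> /nbhs_ballP[e /= e0 xeU].
  (* Chosen so that [2 d < e]: a cube of half-side [d] whose centre is within [d] of [x] lies in the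
     ball of radius [e]. *)
  pose k := Num.truncn (2 / e); pose d : R := k.+1%:R^-1.
  have d0 : 0 < d by rewrite invr_gt0.
  have de : d + d < e.
    have : 2 / e < k.+1%:R by apply: truncnS_gt.
    rewrite /d ltr_pdivrMr// => h.
    have -> : k.+1%:R^-1 + k.+1%:R^-1 = 2 / k.+1%:R :> R by ring.
    by rewrite ltr_pdivrMr// mulrC.
  have /choice[q xq] i : exists q, ratr q \in `](x ord0 i) - d, (x ord0 i) + d[.
    by apply: rat_in_itvoo; lra.
  exists ([ffun i => q i], k).
    move=> y By; apply: xeU; split => // j i; rewrite ord1.
    have := By i; rewrite /= ffunE in_itv/= -/d => /andP[? ?].
    have := xq i; rewrite in_itv/= => /andP[? ?].
    by rewrite /ball/= ltr_norml; apply/andP; split; lra.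
  move=> i; have := xq i; rewrite /= ffunE !in_itv/= -/d => /andP[? ?].
  by apply/andP; split; lra.
rewrite bigcup_mkcond; apply: countable_bigcupT_measurable => // q.
case: ifP => // _; apply: measurable_rect => i; exact: measurable_itv.
Qed.

(** Rectangles are stable under intersection, as uniqueness of a measure from its values on a
    generator demands. *)
Lemma measurable_rVE : @measurable _ 'rV[R]_n =
  <<s [set A | exists2 B : 'I_n -> set (measurableTypeR R),
         (forall i, measurable (B i)) & A = rect B] >>.
Proof.
apply/seteqP; split.
  apply: smallest_sub; first exact: smallest_sigma_algebra.
  move=> A; rewrite -bigcup_seq/= => -[i _ [B mB <-]].
  apply: sub_sigma_algebra; exists (fun j => if j == i then B else setT).
    by move=> j; case: ifP.
  rewrite setTI; apply/seteqP; split => x /=.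
    by move=> Bx j /=; case: eqP => [->|].
  by move=> /(_ i) /=; rewrite eqxx.
apply: smallest_sub; first exact: sigma_algebra_measurable.
by move=> A [B mB ->]; exact: measurable_rect.
Qed.

Lemma measurable_reflect c :
  measurable_fun [set: 'rV[R]_n] (fun y : 'rV[R]_n => c - y).
Proof.
apply: measurable_fun_rV => i; under eq_fun do rewrite !mxE.
apply: measurable_funB; first exact: measurable_cst.
exact: measurable_coord.
Qed.

Lemma measurable_enorm_dist x : measurable_fun [set: 'rV[R]_n]
  (fun y => enorm (x - y) : measurableTypeR R).
Proof.
apply: (@measurability _ _ _ _ _ _ (@RGenOInfty.G R)).
  exact: RGenOInfty.measurableE.
move=> _ [_ [a ->] <-]; rewrite setTI; apply: open_measurable_rV.
apply: open_comp => [y _|]; last exact: rray_open.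
apply: (@continuous_comp _ _ _ (fun y => x - y) (@enorm R n)).
  by apply: continuousB => //; exact: cst_continuous.
exact: continuous_enorm.
Qed.

End fixed_dimension.

Local Open Scope ereal_scope.

Lemma lebesgue_rV_rect n (B : 'I_n -> set (measurableTypeR R)) :
  (forall i, measurable (B i)) ->
  @lebesgue_rV R n (rect B) = \prod_(i < n) lebesgue_measure (B i).
Proof.
elim: n => [|n ih] in B *.
  by move=> _; rewrite big_ord0 /= diracE mem_set// => -[].
move=> mB; rewrite big_ord_recl /= /pushforward.
have rectE : @rV_cons R n @^-1` (rect B) =
    B ord0 `*` rect (fun i => B (lift ord0 i)).
  apply/seteqP; split => -[x v] /= => [xv|[xv vv] i].
    split => [|i]; first by have := xv ord0; rewrite rV_consE0.
    by have := xv (lift ord0 i); rewrite rV_consES.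
  by case: (unliftP ord0 i) => [j|] ->; rewrite ?rV_consE0 ?rV_consES.
rewrite -[LHS]/((_ \x _) (_ @^-1` _)) rectE product_measure1E//=; last first.
  exact: measurable_rect.
by rewrite ih.
Qed.

Lemma lebesgue_measure_reflect (a : R) (A : set (measurableTypeR R)) :
  measurable A ->
  lebesgue_measure ((fun y : measurableTypeR R => a - y)%R @^-1` A) =
  lebesgue_measure A.
Proof.
have mf : measurable_fun [set: measurableTypeR R]
    (fun y : measurableTypeR R => (a - y)%R : measurableTypeR R).
  exact: measurable_funB.
move=> mA; apply/esym.
apply: (@lebesgue_measure_unique R
  (measure_function_pushforward__canonical__measure_function_Measure
    (@lebesgue_measure R) mf)) => //= _ [[u v]] _ <-.
rewrite /pushforward.
rewrite (_ : _ @^-1` _ = [set` `[(a - v)%R, (a - u)%R[ ]); last first.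
  apply/seteqP; split => y /=; rewrite !in_itv/= => /andP[? ?];
    by apply/andP; split; lra.
rewrite !lebesgue_measure_itv/= !lte_fin.
have -> : (a - v < a - u)%R = (u < v)%R by apply/idP/idP; lra.
by case: ifP => // _; rewrite -!EFinB; congr EFin; ring.
Qed.

(** Both measures agree on rectangles, and the cubes []-k, k]^n] of finite measure exhaust the
    space. This symmetry is behind the cancellation in the principal value. *)
Lemma lebesgue_rV_reflect n (c : 'rV[R]_n) (A : set 'rV[R]_n) : measurable A ->
  pushforward (@lebesgue_rV R n) (fun y => c - y)%R A = @lebesgue_rV R n A.
Proof.
move=> mA.
have flip (u v r : R) :
    ((- r < u - v) && (u - v <= r) = (u - r <= v) && (v < u + r))%R.
  by apply/idP/idP => /andP[? ?]; apply/andP; split; lra.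
pose G := [set A | exists2 B : 'I_n -> set (measurableTypeR R),
         (forall i, measurable (B i)) & A = rect B].
pose g (k : nat) : set 'rV[R]_n := @rect n (fun=> `]- k%:R, k%:R]%classic)%R.
apply: (@measure_unique _ R _ G g _ _ _ _
  (measure_function_pushforward__canonical__measure_function_Measure
    (@lebesgue_rV R n) (measurable_reflect c)) (@lebesgue_rV R n)) => //.
- exact: measurable_rVE.
- move=> _ _ [B mB ->] [B' mB' ->]; exists (fun i => B i `&` B' i).
    by move=> i; exact: measurableI.
  apply/seteqP; split => x /=; first by case=> h1 h2 i; split.
  by move=> h; split => i; case: (h i).
- by move=> k; exists (fun=> `]- k%:R, k%:R]%classic)%R.
- apply/seteqP; split => // x _; exists (Num.truncn `|x|).+1 => //= i.
  have h : (`|x ord0 i| < (Num.truncn `|x|).+1%:R)%R.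
    by apply: le_lt_trans (coord_le_norm x i) _; exact: truncnS_gt.
  move: h; rewrite ltr_norml => /andP[h1 h2].
  suff : x ord0 i \in `](- (Num.truncn `|x|).+1%:R)%R,
                        (Num.truncn `|x|).+1%:R%R] by [].
  by rewrite in_itv/= h1 ltW.
- move=> _ [B mB ->]; rewrite /= /pushforward.
  rewrite (_ : _ @^-1` _ = rect (fun i =>
      (fun y : measurableTypeR R => c ord0 i - y)%R @^-1` B i)); last first.
    by apply/seteqP; split => x /= h i; have := h i; rewrite !mxE.
  rewrite !lebesgue_rV_rect//.
    by apply: eq_bigr => i _; rewrite lebesgue_measure_reflect.
  move=> i; rewrite -[X in measurable X]setTI.
  have mf : measurable_fun [set: measurableTypeR R]
      (fun y : measurableTypeR R => (c ord0 i - y)%R : measurableTypeR R).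
    exact: measurable_funB.
  exact: mf.
- move=> k; rewrite /= /pushforward.
  rewrite (_ : _ @^-1` _ = rect (fun i =>
      [set` `[c ord0 i - k%:R, c ord0 i + k%:R[%R])); last first.
    apply/seteqP; split => x /= h i.
      have : (c - x)%R ord0 i \in `](- k%:R)%R, k%:R%R] by exact: h.
      by rewrite !in_itv !mxE/= flip.
    suff : (c - x)%R ord0 i \in `](- k%:R)%R, k%:R%R] by [].
    by have := h i; rewrite /= !in_itv !mxE/= flip.
  rewrite lebesgue_rV_rect//; set P := (X in X < _).
  suff : P \is a fin_num by rewrite ltey_eq => ->.
  rewrite /P; elim/big_ind : _ => //=; first exact: fin_numM.
  by move=> i _; rewrite lebesgue_measure_itv/=; case: ifP.
Qed.

End lebesgue_rV_theory.

(** * Radial integrals *)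

Section lebesgue_rV_integral.
Context {R : realType} (n : nat).
Local Notation mu := (@lebesgue_rV R n).
Implicit Types (x y c : 'rV[R]_n) (A D : set 'rV[R]_n).
Local Open Scope ereal_scope.

Section reflection.
Variables (c : 'rV[R]_n) (D : set 'rV[R]_n) (f : 'rV[R]_n -> \bar R).
Hypothesis mD : measurable D.
Hypothesis symD : (fun y => c - y)%R @^-1` D = D.
Hypothesis mf : measurable_fun [set: 'rV[R]_n] f.
Hypothesis intf : mu.-integrable D f.

Let refl_measure : {measure set 'rV[R]_n -> \bar R} :=
  measure_function_pushforward__canonical__measure_function_Measure
    mu (measurable_reflect c).

Let g y := f (c - y)%R.

Let mg : measurable_fun [set: 'rV[R]_n] g.
Proof. exact: (measurableT_comp mf (measurable_reflect c)). Qed.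

Let gK : g \o (fun y => c - y)%R = f.
Proof. by apply/funext => y; rewrite /g/= subKr. Qed.

Let refl_integral h :
  \int[refl_measure]_(y in D) h y = \int[mu]_(y in D) h y.
Proof.
by apply: eq_measure_integral => A mA _; exact: lebesgue_rV_reflect.
Qed.

(** The pushforward of [mu] by the reflection is [mu] itself, so the transfer theorem for
    pushforwards becomes an invariance. *)
Lemma integrable_reflect : mu.-integrable D (fun y => f (c - y)%R).
Proof.
have /(_ mD) : measurable D -> refl_measure.-integrable D g.
  apply: integrable_pushforward => //; first exact: measurable_reflect.
  by rewrite gK symD.
move=> /integrableP[mgD gD]; apply/integrableP; split => //.
by rewrite -refl_integral.
Qed.

Lemma integral_reflect :
  \int[mu]_(y in D) f (c - y)%R = \int[mu]_(y in D) f y.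
Proof.
rewrite -[LHS]refl_integral.
have -> : \int[refl_measure]_(y in D) g y =
    \int[mu]_(y in (fun y => c - y)%R @^-1` D) (g \o (fun y => c - y)%R) y.
  apply: integral_pushforward => //; first exact: measurable_reflect.
  by rewrite gK symD.
by rewrite gK symD.
Qed.

End reflection.

Lemma measurable_enorm_ge x (r : R) :
  measurable [set y | (r <= enorm (x - y))%R].
Proof.
rewrite -[X in measurable X]setTI.
rewrite (_ : mkset _ = (fun y => enorm (x - y)) @^-1` `[r, +oo[%classic).
  exact: measurable_enorm_dist.
by apply/seteqP; split => y; rewrite /= in_itv/= andbT.
Qed.

Lemma measurable_enorm_lt x (r : R) :
  measurable [set y | (enorm (x - y) < r)%R].
Proof.
rewrite (_ : mkset _ = ~` [set y | (r <= enorm (x - y))%R]).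
  by apply: measurableC; exact: measurable_enorm_ge.
by apply/seteqP; split => y /=; rewrite ltNge => /negP.
Qed.

Lemma measurable_annulus x (a b : R) :
  measurable [set y | (a <= enorm (x - y) < b)%R].
Proof.
rewrite (_ : mkset _ = [set y | (a <= enorm (x - y))%R] `&`
                       [set y | (enorm (x - y) < b)%R]).
  by apply: measurableI;
    [exact: measurable_enorm_ge|exact: measurable_enorm_lt].
by apply/seteqP; split => y /=; [move=> /andP[]|move=> [-> ->]].
Qed.

Lemma measurable_punctured_ball x (r : R) :
  measurable [set y | (0 < enorm (x - y) < r)%R].
Proof.
rewrite (_ : mkset _ = ~` [set y | (enorm (x - y) <= 0)%R] `&`
                       [set y | (enorm (x - y) < r)%R]).
  apply: measurableI; last exact: measurable_enorm_lt.
  apply: measurableC; rewrite -[X in measurable X]setTI.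
  rewrite (_ : mkset _ = (fun y => enorm (x - y)) @^-1` `]-oo, 0%R]%classic).
    exact: measurable_enorm_dist.
  by apply/seteqP; split => y; rewrite /= in_itv.
apply/seteqP; split => y /=; first by rewrite ltNge => /andP[/negP].
by move=> [/negP]; rewrite -ltNge => -> ->.
Qed.

Lemma measurable_enorm_powR x (e : R) (D : set 'rV[R]_n) :
  measurable_fun D (fun y => (enorm (x - y) `^ e)%:E).
Proof.
apply: measurable_funTS; apply/measurable_EFinP.
exact: (measurableT_comp (@measurable_powR R e) (measurable_enorm_dist x)).
Qed.

Lemma lebesgue_rV_cube_le x (r : R) (A : set 'rV[R]_n) : (0 <= r)%R ->
  measurable A -> (A `<=` [set y | enorm (x - y) < r]%R) ->
  mu A <= ((2 * r) ^+ n)%:E.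
Proof.
move=> r0 mA Ar.
pose a i := (x ord0 i - r)%R; pose b i := (x ord0 i + r)%R.
pose B := [set y : 'rV[R]_n | forall i, y ord0 i \in `]a i, b i]].
have mB : measurable B.
  apply: (@measurable_rect R n (fun i => [set` `]a i, b i]])) => i.
  exact: measurable_itv.
have -> : ((2 * r) ^+ n)%:E = mu B.
  rewrite lebesgue_rV_box; last by move=> i; rewrite /a /b; lra.
  congr EFin; rewrite -[in LHS](card_ord n) -prodr_const; apply: eq_bigr => i _.
  by rewrite /a /b; lra.
apply: le_measure; rewrite ?inE// => y /Ar/= yr i.
have := le_lt_trans (coord_le_enorm (x - y) i) yr.
rewrite !mxE ltr_norml in_itv/= /a /b => /andP[? ?].
by apply/andP; split; lra.
Qed.

(** On the annulus [|x - y| / r] lies between 1 and 2, which costs at most [2^|e|] whatever the sign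
    of [e]; [4^n] is the scaled volume of a cube of side [4 r]. *)
Lemma integral_annulus_le x (e r : R) : (0 < r)%R ->
  \int[mu]_(y in [set y | (r <= enorm (x - y) < 2 * r)%R])
    (enorm (x - y) `^ e)%:E <=
  ((2 `^ `|e| * 4 ^+ n) * r `^ (e + n%:R))%:E.
Proof.
move=> r0; set D := mkset _.
have mD : measurable D by exact: measurable_annulus.
apply: (@le_trans _ _ (\int[mu]_(y in D) (2 `^ `|e| * r `^ e)%:E)).
  apply: ge0_le_integral => //.
  - by move=> y _; rewrite lee_fin powR_ge0.
  - exact: measurable_enorm_powR.
  move=> y; rewrite /D/= lee_fin => /andP[ry yr].
  have y0 : (0 < enorm (x - y))%R by exact: lt_le_trans ry.
  have -> : enorm (x - y) = (enorm (x - y) / r * r)%R.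
    by rewrite divfK// gt_eqF.
  rewrite powRM ?divr_ge0// ?(ltW r0) ?(ltW y0)// ler_wpM2r ?powR_ge0//.
  have u1 : (1 <= enorm (x - y) / r)%R by rewrite ler_pdivlMr ?mul1r.
  have u2 : (enorm (x - y) / r <= 2)%R by rewrite ler_pdivrMr// ltW.
  apply: (@le_trans _ _ ((enorm (x - y) / r) `^ `|e|))%R.
    by apply: ler_powR => //; exact: ler_norm.
  by rewrite ge0_ler_powR ?nnegrE//; exact: le_trans u1.
rewrite integral_cst//.
apply: (@le_trans _ _ ((2 `^ `|e| * r `^ e)%:E * ((2 * (2 * r)) ^+ n)%:E)).
  apply: lee_wpmul2l; first by rewrite lee_fin mulr_ge0 ?powR_ge0.
  apply: (lebesgue_rV_cube_le (x := x)) => //; first by rewrite mulr_ge0// ltW.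
  by move=> y /andP[].
rewrite -EFinM lee_fin powRD; last by rewrite (gt_eqF r0) implybT.
rewrite powR_mulrn ?(ltW r0)// mulrA exprMn.
have -> : (4 ^+ n = 2 ^+ n * 2 ^+ n :> R)%R.
  by rewrite -exprMn; congr (_ ^+ _)%R; ring.
by rewrite exprMn; lra.
Qed.

(** Stands in for polar coordinates: powers of the distance are integrated annulus by annulus, and
    dyadic radii make the contributions geometric. *)
Lemma integral_geometric_cover (F : (set 'rV[R]_n)^nat)
    (f : 'rV[R]_n -> \bar R) (C z : R) :
  (forall k, measurable (F k)) -> trivIset setT F ->
  measurable_fun (\bigcup_k F k) f -> (forall y, 0 <= f y) ->
  (0 <= C)%R -> (0 <= z < 1)%R ->
  (forall k, \int[mu]_(y in F k) f y <= (C * z ^+ k)%:E) ->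
  \int[mu]_(y in \bigcup_k F k) f y <= (C / (1 - z))%:E.
Proof.
move=> mF tF mf f0 C0 /andP[z0 z1] fC.
rewrite ge0_integral_bigcup//.
apply: lime_le.
  by apply: is_cvg_nneseries => k _ _; exact: integral_ge0.
apply: nearW => k; apply: (@le_trans _ _ (\sum_(0 <= i < k) (C * z ^+ i)%:E)).
  by apply: lee_sum => i _; exact: fC.
rewrite sumEFin lee_fin -mulr_sumr ler_wpM2l//.
have z1' : (0 < 1 - z)%R by lra.
rewrite -[leRHS]mul1r ler_pdivlMr// big_mkord.
rewrite -[leLHS]opprK -mulrN opprB mulrC -subrX1 opprB.
by have := exprn_ge0 k z0; lra.
Qed.

Lemma expr_half_lt (u : R) : (0 < u)%R -> exists k, (2^-1 ^+ k <= u)%R.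
Proof.
move=> u0; exists (Num.truncn u^-1); set k := Num.truncn _.
have uk : (u^-1 <= 2 ^+ k)%R.
  apply: ltW; apply: (@lt_le_trans _ _ k.+1%:R%R); first exact: truncnS_gt.
  by rewrite -natrX ler_nat ltn_expl.
by rewrite exprVn -[leRHS]invrK lef_pV2 ?posrE ?invr_gt0 ?exprn_gt0.
Qed.

Let half_powR (a : R) (k : nat) : ((2 ^+ k) `^ (- a) = (2 `^ (- a)) ^+ k)%R.
Proof. by rewrite -!powR_mulrn ?powR_ge0// -!powRrM mulrC. Qed.

Let half_powR01 (a : R) : (0 < a)%R -> (0 <= 2 `^ (- a) < 1)%R.
Proof.
move=> a0; rewrite powR_ge0 powRN invf_lt1 ?powR_gt0//=.
have := @gt0_ltr_powR R a a0 1%R 2%R.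
by rewrite powR1 !nnegrE => /(_ ler01 (ler0n _ _)); apply; rewrite ltr1n.
Qed.

(** The annulus of inner radius [2^k r] contributes at most a constant times [(2^k r)^(- a)], a
    geometric sequence of ratio [2^(- a) < 1]. *)
Lemma integral_enorm_tail (a : R) : (0 < a)%R -> exists2 C : R, (0 <= C)%R &
  forall x r, (0 < r)%R ->
  \int[mu]_(y in [set y | (r <= enorm (x - y))%R])
     (enorm (x - y) `^ (- (n%:R + a)))%:E <= (C * r `^ (- a))%:E.
Proof.
move=> a0; have /andP[z0 z1] := half_powR01 a0.
pose K : R := (2 `^ `|- (n%:R + a)| * 4 ^+ n)%R.
have K0 : (0 <= K)%R by rewrite mulr_ge0 ?powR_ge0 ?exprn_ge0.
exists (K / (1 - 2 `^ (- a)))%R; first by rewrite divr_ge0//; lra.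
move=> x r r0.
pose F k := [set y | (2 ^+ k * r <= enorm (x - y) < 2 * (2 ^+ k * r))%R].
have -> : [set y | (r <= enorm (x - y))%R] = \bigcup_k F k.
  apply/seteqP; split => [y /= ry|y [k _ /andP[+ _]]]; last first.
    by apply: le_trans; rewrite ler_peMl ?(ltW r0)// exprn_ege1// ler1n.
  have y0 : (0 < enorm (x - y))%R by exact: lt_le_trans ry.
  have [k0 hk0] := @expr_half_lt (r / enorm (x - y)) (divr_gt0 r0 y0).
  have ex : exists k, (enorm (x - y) < 2 * (2 ^+ k * r))%R.
    exists k0; move: hk0; rewrite ler_pdivlMr// exprVn.
    rewrite mulrC ler_pdivrMr ?exprn_gt0// => h.
    have : (0 < r * 2 ^+ k0)%R by rewrite mulr_gt0// exprn_gt0.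
    by lra.
  have [k hk kmin] := ex_minnP ex; exists k => //; rewrite /F/= hk andbT.
  case: k hk kmin => [_ _|k _ kmin]; first by rewrite expr0 mul1r.
  rewrite leNgt; apply/negP; rewrite exprS -mulrA => /kmin.
  by rewrite ltnn.
have -> : (K / (1 - 2 `^ (- a)) * r `^ (- a) =
  K * r `^ (- a) / (1 - 2 `^ (- a)))%R by rewrite mulrAC.
apply: integral_geometric_cover => //.
- by move=> k; exact: measurable_annulus.
- apply: ltn_trivIset => i j ij; apply/seteqP; split => // y [].
  rewrite /F/= => /andP[_ h2] /andP[h1 _].
  have : (2 * (2 ^+ j * r) <= 2 ^+ i * r)%R.
    by rewrite mulrA -exprS ler_pM2r// ler_weXn2l// ler1n.
  by lra.
- exact: measurable_enorm_powR.
- by move=> y; rewrite lee_fin powR_ge0.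
- by rewrite mulr_ge0 ?powR_ge0.
- by rewrite z0 z1.
move=> k; apply: le_trans (integral_annulus_le _ _ _) _.
  by rewrite mulr_gt0 ?exprn_gt0.
rewrite -/K lee_fin -mulrA ler_wpM2l//.
have -> : (- (n%:R + a) + n%:R = - a :> R)%R by ring.
by rewrite powRM ?exprn_ge0 ?(ltW r0)// half_powR mulrC.
Qed.

Lemma integral_enorm_near (a : R) : (0 < a)%R -> exists2 C : R, (0 <= C)%R &
  forall x r, (0 < r)%R ->
  \int[mu]_(y in [set y | (0 < enorm (x - y) < r)%R])
     (enorm (x - y) `^ (a - n%:R))%:E <= (C * r `^ a)%:E.
Proof.
move=> a0; have /andP[z0 z1] := half_powR01 a0.
pose K : R := (2 `^ `|a - n%:R| * 4 ^+ n)%R.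
have K0 : (0 <= K)%R by rewrite mulr_ge0 ?powR_ge0 ?exprn_ge0.
exists (K / (1 - 2 `^ (- a)))%R; first by rewrite divr_ge0//; lra.
move=> x r r0.
(* The exponent [k.+1] makes the outermost annulus run from [r / 2] to [r]. The centre lies in no
   annulus, hence the punctured ball. *)
pose F k := [set y | (2^-1 ^+ k.+1 * r <= enorm (x - y) <
                      2 * (2^-1 ^+ k.+1 * r))%R].
have FE k : (2 * (2^-1 ^+ k.+1 * r) = 2^-1 ^+ k * r :> R)%R.
  by rewrite exprS; field.
have -> : [set y | (0 < enorm (x - y) < r)%R] = \bigcup_k F k.
  apply/seteqP; split => [y /= /andP[y0 yr]|y [k _]]; last first.
    rewrite /F/= FE => /andP[h1 h2].
    rewrite (lt_le_trans _ h1) ?mulr_gt0 ?exprn_gt0 ?invr_gt0//=.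
    by rewrite (lt_le_trans h2)// ler_piMl ?(ltW r0)// exprn_ile1//;
      rewrite ?invr_ge0// invf_le1// ler1n.
  have [k0 hk0] := @expr_half_lt (enorm (x - y) / r) (divr_gt0 y0 r0).
  have ex : exists k, (2^-1 ^+ k.+1 * r <= enorm (x - y))%R.
    exists k0; move: hk0; rewrite ler_pdivlMr// exprS => h.
    have : (0 < 2^-1 ^+ k0 * r :> R)%R.
      by rewrite mulr_gt0// exprn_gt0// invr_gt0.
    by lra.
  have [k hk kmin] := ex_minnP ex; exists k => //; rewrite /F/= hk FE/=.
  case: k hk kmin => [_ _|k _ kmin]; first by rewrite expr0 mul1r.
  rewrite ltNge; apply/negP => /kmin.
  by rewrite ltnn.
have -> : (K / (1 - 2 `^ (- a)) * r `^ a =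
  K * r `^ a / (1 - 2 `^ (- a)))%R by rewrite mulrAC.
apply: integral_geometric_cover => //.
- by move=> k; exact: measurable_annulus.
- apply: ltn_trivIset => i j ij; apply/seteqP; split => // y [].
  rewrite /F/= !FE => /andP[h2 _] /andP[_ h1].
  have : (2^-1 ^+ i * r <= 2^-1 ^+ j.+1 * r)%R.
    rewrite ler_pM2r// ler_wiXn2l//.
    by rewrite invf_le1// ler1n.
  by lra.
- exact: measurable_enorm_powR.
- by move=> y; rewrite lee_fin powR_ge0.
- by rewrite mulr_ge0 ?powR_ge0.
- by rewrite z0 z1.
move=> k; apply: le_trans (integral_annulus_le _ _ _) _.
  by rewrite mulr_gt0 ?exprn_gt0 ?invr_gt0.
rewrite -/K lee_fin -mulrA ler_wpM2l// subrK.
have -> : (2^-1 ^+ k.+1 * r = 2^-1 * (2^-1 ^+ k * r) :> R)%R.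
  by rewrite exprS mulrA.
rewrite powRM ?mulr_ge0 ?exprn_ge0 ?invr_ge0 ?(ltW r0)//.
rewrite powRM ?exprn_ge0 ?invr_ge0 ?(ltW r0)//.
have -> : ((2^-1 ^+ k) `^ a = 2 `^ (- a) ^+ k :> R)%R.
  by rewrite -half_powR powRN -[X in _ = X]powR_inv1 ?powR_ge0//
    exprVn -[in LHS]powR_inv1 ?exprn_ge0// powRAC.
rewrite [leRHS]mulrC -[leRHS]mul1r ler_wpM2r//.
  by rewrite mulr_ge0 ?exprn_ge0 ?powR_ge0.
have := @ge0_ler_powR R a (ltW a0) 2^-1%R 1%R; rewrite powR1; apply.
- by rewrite nnegrE invr_ge0.
- by rewrite nnegrE.
- by rewrite invf_le1// ler1n.
Qed.

End lebesgue_rV_integral.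

(** * Principal values *)

Section principal_value.
Context {R : realType} (n : nat).
Local Notation mu := (@lebesgue_rV R n).
Implicit Types (x y : 'rV[R]_n) (f F : 'rV[R]_n -> R).

Lemma ge0_integrable_le D f (c : R) : measurable D ->
  measurable_fun D (EFin \o f) -> (forall y, D y -> 0 <= f y) ->
  (\int[mu]_(y in D) (f y)%:E <= c%:E)%E ->
  mu.-integrable D (EFin \o f) /\ \int[mu]_(y in D) f y <= c.
Proof.
move=> mD mf f0 fc.
have fin : (\int[mu]_(y in D) (f y)%:E < +oo)%E.
  by apply: le_lt_trans fc _; rewrite ltry.
split.
  apply/integrableP; split => //.
  rewrite (_ : (\int[mu]_(y in D) `|(EFin \o f) y|)%E =
    (\int[mu]_(y in D) (f y)%:E)%E)//.
  apply: eq_integral => y /set_mem Dy /=.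
  by rewrite ger0_norm// f0.
rewrite -lee_fin /Rintegral fineK// ge0_fin_numE//.
by apply: integral_ge0 => y Dy; rewrite lee_fin f0.
Qed.

Lemma Rintegral_enorm_tail (a : R) : 0 < a -> exists2 C : R, 0 <= C &
  forall x r, 0 < r ->
  let D := [set y | r <= enorm (x - y)] in
  let f y := enorm (x - y) `^ (- (n%:R + a)) in
  mu.-integrable D (EFin \o f) /\ \int[mu]_(y in D) f y <= C * r `^ (- a).
Proof.
move=> a0; have [C C0 hC] := @integral_enorm_tail R n a a0.
exists C => // x r r0 D f; apply: ge0_integrable_le.
- exact: measurable_enorm_ge.
- exact: measurable_enorm_powR.
- by move=> y _; exact: powR_ge0.
- exact: hC.
Qed.

Lemma Rintegral_enorm_near (a : R) : 0 < a -> exists2 C : R, 0 <= C &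
  forall x r, 0 < r ->
  let D := [set y | 0 < enorm (x - y) < r] in
  let f y := enorm (x - y) `^ (a - n%:R) in
  mu.-integrable D (EFin \o f) /\ \int[mu]_(y in D) f y <= C * r `^ a.
Proof.
move=> a0; have [C C0 hC] := @integral_enorm_near R n a a0.
exists C => // x r r0 D f; apply: ge0_integrable_le.
- exact: measurable_punctured_ball.
- exact: measurable_enorm_powR.
- by move=> y _; exact: powR_ge0.
- exact: hC.
Qed.

Lemma integrable_dominated D f g (k : R) : measurable D -> 0 <= k ->
  measurable_fun D f -> mu.-integrable D (EFin \o g) ->
  (forall y, D y -> `|f y| <= k * g y) -> mu.-integrable D (EFin \o f).
Proof.
move=> mD k0 mf ig fg.
apply: (@le_integrable _ _ _ mu D mD _ (fun y => k%:E * (EFin \o g) y)%E).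
- exact/measurable_EFinP.
- move=> y Dy /=; rewrite lee_fin (le_trans (fg y Dy))//.
  exact: ler_norm.
- exact: integrableZl.
Qed.

Lemma enorm_reflect x y : enorm (x - (x + x - y)) = enorm (x - y).
Proof.
by rewrite enormB; congr enorm; rewrite addrAC addrK.
Qed.

(* Pairing [y] with its reflection [2x - y] cancels the odd part of the
   singularity of [F] at [x]. *)
Lemma cvg_principal_value x F (a b r A B : R) : 0 < a -> 0 < b -> 0 < r ->
  0 <= A -> 0 <= B -> measurable_fun [set: 'rV[R]_n] F ->
  (forall y, 0 < enorm (x - y) ->
    `|F y| <= A * enorm (x - y) `^ (- (n%:R + a))) ->
  (forall y, 0 < enorm (x - y) < r ->
    `|F y + F (x + x - y)| <= B * enorm (x - y) `^ (b - n%:R)) ->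
  (\int[mu]_(y in [set y | (eps <= enorm (x - y))%R]) (F y)%:E)%E
    @[eps --> 0^'+] -->
  (\int[mu]_(y in [set y | r <= enorm (x - y)]) F y +
   2^-1 * \int[mu]_(y in [set y | 0 < enorm (x - y) < r])
            (F y + F (x + x - y)))%:E.
Proof.
move=> a0 b0 r0 A0 B0 mF FA FB.
have [Ct Ct0 hCt] := Rintegral_enorm_tail a0.
have [Cn Cn0 hCn] := Rintegral_enorm_near b0.
pose G y := F y + F (x + x - y).
have mG : measurable_fun [set: 'rV[R]_n] G.
  apply: measurable_funD => //.
  exact: (measurableT_comp mF (measurable_reflect (x + x))).
have intF e : 0 < e ->
    mu.-integrable [set y | e <= enorm (x - y)] (EFin \o F).
  move=> e0; have [it _] := hCt x e e0.
  apply: (integrable_dominated _ A0 _ it).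
  - exact: measurable_enorm_ge.
  - exact: measurable_funTS.
  - by move=> y ey; apply: FA; exact: lt_le_trans ey.
have intG e : 0 < e <= r ->
    mu.-integrable [set y | 0 < enorm (x - y) < e] (EFin \o G).
  move=> /andP[e0 er]; have [it _] := hCn x e e0.
  apply: (integrable_dominated _ B0 _ it).
  - exact: measurable_punctured_ball.
  - exact: measurable_funTS.
  - move=> y /andP[y0 ye]; apply: FB.
    by rewrite y0 (lt_le_trans ye).
(* On the annulus between [e] and [r], reflection gives [G] twice the integral of [F]. The truncated
   integral is thus its expected limit minus half the integral of [G] over a small punctured
   ball. *)
have key e : 0 < e < r ->
    (\int[mu]_(y in [set y | (e <= enorm (x - y))%R]) (F y)%:E)%E =
    (\int[mu]_(y in [set y | r <= enorm (x - y)]) F y +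
     2^-1 * \int[mu]_(y in [set y | (0 < enorm (x - y) < r)]) G y -
     2^-1 * \int[mu]_(y in [set y | (0 < enorm (x - y) < e)]) G y)%:E.
  move=> /andP[e0 er].
  have mAnn : measurable [set y | e <= enorm (x - y) < r].
    exact: measurable_annulus.
  have intFA : mu.-integrable [set y | e <= enorm (x - y) < r] (EFin \o F).
    apply: integrableS (intF e e0) => //; first exact: measurable_enorm_ge.
    by move=> y /andP[].
  have symA : (fun y => x + x - y) @^-1` [set y | e <= enorm (x - y) < r] =
      [set y | e <= enorm (x - y) < r].
    by apply/seteqP; split => y /=; rewrite enorm_reflect.
  have mFE : measurable_fun [set: 'rV[R]_n] (EFin \o F).
    exact/measurable_EFinP.
  have eG : \int[mu]_(y in [set y | e <= enorm (x - y) < r]) G y =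
      2 * \int[mu]_(y in [set y | e <= enorm (x - y) < r]) F y.
    rewrite /G RintegralD//; last exact: (integrable_reflect mAnn symA mFE).
    rewrite mulr2n mulrDl mul1r; congr (_ + _).
    by rewrite /Rintegral; congr fine; exact: (integral_reflect mAnn symA mFE).
  rewrite -[LHS]fineK; last first.
    by apply: integrable_fin_num; [exact: measurable_enorm_ge|exact: intF].
  congr EFin; rewrite -/(Rintegral _ _ _).
  have -> : [set y | e <= enorm (x - y)] =
      [set y | e <= enorm (x - y) < r] `|` [set y | r <= enorm (x - y)].
    apply/seteqP; split => y /=.
      by move=> ->; case: ltP => _; [left|right].
    by case=> [/andP[]//|]; apply: le_trans; exact: ltW.
  rewrite Rintegral_setU//; first last.
  - apply/disj_setPS => y [/= /andP[_ yr]]; rewrite leNgt yr//.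
  - have -> : [set y | e <= enorm (x - y) < r] `|` [set y | r <= enorm (x - y)]
      = [set y | e <= enorm (x - y)].
      apply/seteqP; split => y /=.
        by case=> [/andP[]//|]; apply: le_trans; exact: ltW.
      by move=> ->; case: ltP => _; [left|right].
    exact: intF.
  - exact: measurable_enorm_ge.
  have -> : \int[mu]_(y in [set y | (0 < enorm (x - y) < r)]) G y =
      \int[mu]_(y in [set y | (0 < enorm (x - y) < e)]) G y +
      \int[mu]_(y in [set y | e <= enorm (x - y) < r]) G y.
    have E : [set y | 0 < enorm (x - y) < r] =
        [set y | 0 < enorm (x - y) < e] `|` [set y | e <= enorm (x - y) < r].
      apply/seteqP; split => y /=.
        by move=> /andP[-> ->]; case: ltP => _; [left|right].
      case=> [/andP[-> /lt_trans]|/andP[/(lt_le_trans e0) -> ->//]].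
      exact.
    rewrite E Rintegral_setU//.
    - exact: measurable_punctured_ball.
    - by rewrite -E; apply: intG; rewrite r0/=.
    - by apply/disj_setPS => y [/= /andP[_ ye]] /andP[]; rewrite leNgt ye.
  by rewrite eG; lra.
pose I := \int[mu]_(y in [set y | r <= enorm (x - y)]) F y +
   2^-1 * \int[mu]_(y in [set y | 0 < enorm (x - y) < r]) G y.
have : I - 2^-1 * \int[mu]_(y in [set y | (0 < enorm (x - y) < e)]) G y
    @[e --> 0^'+] --> I.
  rewrite -[X in _ --> X]subr0; apply: cvgB; first exact: cvg_cst.
  apply/norm_cvg0P.
  (* The remaining integral over the ball of radius [e] is [O(e^b)]. *)
  have small : (2^-1 * B * Cn) * e `^ b @[e --> 0^'+] --> (0 : R).
    rewrite -[X in _ --> X](mulr0 (2^-1 * B * Cn)).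
    by apply: cvgM; [exact: cvg_cst|exact: powR_cvg0].
  apply: (squeeze_cvgr _ (cvg_cst 0) small).
  near=> e; rewrite normr_ge0/=.
  have e0 : 0 < e by near: e; exact: nbhs_right_gt.
  have er : e <= r by near: e; exact: nbhs_right_le.
  have [it le] := hCn x e e0.
  rewrite normrM ger0_norm ?invr_ge0// -!mulrA ler_wpM2l ?invr_ge0//.
  have iG := intG e; rewrite e0 er in iG; have {}iG := iG isT.
  apply: le_trans (le_normr_Rintegral _ iG) _.
    exact: measurable_punctured_ball.
  apply: (@le_trans _ _ (\int[mu]_(y in [set y | 0 < enorm (x - y) < e])
     (B * enorm (x - y) `^ (b - n%:R)))).
    apply: le_Rintegral.
    - exact: measurable_punctured_ball.
    - exact: integrable_norm.
    - by apply: (integrableZl _ B it); exact: measurable_punctured_ball.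
    - by move=> y /andP[y0 ye]; apply: FB; rewrite y0 (lt_le_trans ye).
  rewrite RintegralZl//; last exact: measurable_punctured_ball.
  by rewrite ler_wpM2l.
move=> cvgI; apply: (@cvg_trans _ (EFin (I - 2^-1 *
    \int[mu]_(y in [set y | (0 < enorm (x - y) < e)]) G y) @[e --> 0^'+])).
  apply: near_eq_cvg; near=> e; rewrite key//; apply/andP; split.
    by near: e; exact: nbhs_right_gt.
  by near: e; exact: nbhs_right_lt.
by apply: cvg_EFin => //; exact: nearW.
Unshelve. all: by end_near. Qed.

End principal_value.

(** * Lower bounds for principal values *)

Section principal_value_lower_bound.
Context {R : realType} (n : nat).
Local Notation mu := (@lebesgue_rV R n).
Implicit Types (x y : 'rV[R]_n) (F : 'rV[R]_n -> R).

(** There are two families of constants: [A] and [B] only certify integrability and are absent from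
    the bound, while [A1] and [B1] control the negative part of the integrand. The gain comes from
    the set [Q], where [F] is at least [c]. *)
Lemma principal_value_ge x F (a a1 b r c A A1 B B1 CT CN : R) Q :
  0 < a -> 0 < a1 -> 0 < b -> 0 < r ->
  0 <= A -> 0 <= A1 -> 0 <= B -> 0 <= B1 ->
  measurable_fun [set: 'rV[R]_n] F ->
  (forall y, 0 < enorm (x - y) ->
    `|F y| <= A * enorm (x - y) `^ (- (n%:R + a))) ->
  (forall y, 0 < enorm (x - y) < r ->
    `|F y + F (x + x - y)| <= B * enorm (x - y) `^ (b - n%:R)) ->
  (forall y, 0 < enorm (x - y) < r ->
    - (B1 * enorm (x - y) `^ (b - n%:R)) <= F y + F (x + x - y)) ->
  (forall y, r <= enorm (x - y) ->
    - (A1 * enorm (x - y) `^ (- (n%:R + a1))) <= F y) ->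
  \int[mu]_(y in [set y | r <= enorm (x - y)])
    enorm (x - y) `^ (- (n%:R + a1)) <= CT ->
  \int[mu]_(y in [set y | 0 < enorm (x - y) < r])
    enorm (x - y) `^ (b - n%:R) <= CN ->
  measurable Q -> (mu Q < +oo)%E -> Q `<=` [set y | r <= enorm (x - y)] ->
  0 <= c -> (forall y, Q y -> c <= F y) ->
  c * fine (mu Q) - A1 * CT - 2^-1 * (B1 * CN) <=
  \int[mu]_(y in [set y | r <= enorm (x - y)]) F y +
   2^-1 * \int[mu]_(y in [set y | 0 < enorm (x - y) < r])
            (F y + F (x + x - y)).
Proof.
have ar1 (w u v k : R) : u <= v + w -> w <= k -> u - k <= v by lra.
have ar2 (u v k l : R) : k <= u -> - l <= v ->
  k - 2^-1 * l <= u + 2^-1 * v by lra.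
move=> a0 a10 b0 r0 A0 A10 B0 B10 mF FA FB FB1 FA1 hCT hCN mQ Qoo Qr c0 FQ.
set far := [set y | r <= enorm (x - y)] in FA1 Qr hCT *.
set near0 := [set y | 0 < enorm (x - y) < r] in hCN *.
have mfar : measurable far by exact: measurable_enorm_ge.
have mnear : measurable near0 by exact: measurable_punctured_ball.
have [Ct _ hCt] := @Rintegral_enorm_tail R n a a0.
have [Ct1 _ hCt1] := @Rintegral_enorm_tail R n a1 a10.
have [Cn _ hCn] := @Rintegral_enorm_near R n b b0.
have intF : mu.-integrable far (EFin \o F).
  have [it _] := hCt x r r0.
  apply: (integrable_dominated mfar A0 _ it); first exact: measurable_funTS.
  by move=> y ry; apply: FA; exact: lt_le_trans ry.
have int1 : mu.-integrable far
    (EFin \o (fun y => A1 * enorm (x - y) `^ (- (n%:R + a1)))).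
  have [it _] := hCt1 x r r0.
  exact: (integrableZl mfar A1 it).
have intG : mu.-integrable near0 (EFin \o (fun y => F y + F (x + x - y))).
  have [it _] := hCn x r r0.
  apply: (integrable_dominated mnear B0 _ it) => //.
  apply: measurable_funTS; apply: measurable_funD => //.
  exact: (measurableT_comp mF (measurable_reflect (x + x))).
have intH : mu.-integrable far (EFin \o
    (fun y => F y + A1 * enorm (x - y) `^ (- (n%:R + a1)))).
  exact: (integrableD mfar intF int1).
have lowfar : c * fine (mu Q) - A1 * CT <= \int[mu]_(y in far) F y.
  have e1 : \int[mu]_(y in far) (F y + A1 * enorm (x - y) `^ (- (n%:R + a1))) =
      \int[mu]_(y in far) F y +
      A1 * \int[mu]_(y in far) enorm (x - y) `^ (- (n%:R + a1)).
    by rewrite RintegralD// RintegralZl//; have [] := hCt1 x r r0.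
  (* With the tail added back the integrand is nonnegative on [far], so discarding the points
     outside [Q] only lowers the integral. *)
  have e2 : c * fine (mu Q) <= \int[mu]_(y in far)
      (F y + A1 * enorm (x - y) `^ (- (n%:R + a1))).
    rewrite -(setDUK Qr) Rintegral_setU//.
    - rewrite -[leLHS]addr0; apply: lerD; last first.
        by apply: Rintegral_ge0 => y [/FA1 h _]; rewrite -lerBlDr sub0r.
      rewrite -Rintegral_cst//; apply: le_Rintegral => //.
      + apply: measurable_bounded_integrable => //.
        exists `|c|; split; first exact: num_real.
        by move=> k ck y _; rewrite /= ltW.
      + exact: integrableS intH.
      + move=> y Qy; apply: le_trans (FQ _ Qy) _.
        by rewrite lerDl mulr_ge0// powR_ge0.
    - exact: measurableD.
    - by rewrite setDUK.
    - by rewrite disj_set2E setDIK.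
  by rewrite e1 in e2; apply: (ar1 _ _ _ _ e2); rewrite ler_wpM2l.
apply: ar2 => //.
have [it _] := hCn x r r0.
apply: (@le_trans _ _ (\int[mu]_(y in near0)
    (- B1 * enorm (x - y) `^ (b - n%:R)))).
  by rewrite RintegralZl// mulNr lerN2 ler_wpM2l.
apply: le_Rintegral => //; first exact: (integrableZl mnear (- B1) it).
by move=> y yr; rewrite mulNr; exact: FB1.
Qed.

(** A strict superlevel set at a level [a >= 0] lies in [U] and is open by continuity there; at a
    negative level it is the whole space. *)
Lemma measurable_zero_extension (U : set 'rV[R]_n) (u : 'rV[R]_n -> R) :
  open U -> (forall x, U x -> {for x, continuous u}) ->
  (forall x, ~ U x -> u x = 0) -> (forall x, 0 <= u x) ->
  measurable_fun [set: 'rV[R]_n] u.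
Proof.
move=> oU cu u0 uge0.
apply: (@measurability _ _ _ _ _ _ (@RGenOInfty.G R)).
  exact: RGenOInfty.measurableE.
move=> _ [_ [a ->] <-]; rewrite setTI.
have [a0|a0] := ltP a 0.
  rewrite (_ : _ @^-1` _ = setT); first exact: measurableT.
  apply/seteqP; split => // y _; rewrite /= in_itv/= andbT.
  exact: lt_le_trans a0 _.
apply: open_measurable_rV; rewrite openE => y.
rewrite /= in_itv/= andbT => ay.
have Uy : U y.
  by apply: contrapT => /u0 uy; move: ay; rewrite uy ltNge a0.
apply: (cu y Uy); apply: open_nbhs_nbhs; split; first exact: rray_open.
by rewrite /= in_itv/= andbT.
Qed.

End principal_value_lower_bound.

(** * The operator as a symmetrised integral *)

Section frac_plap_principal_value.
Context {R : realType} (n : nat).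
Local Notation mu := (@lebesgue_rV R n).
Variables (s p : R) (u : 'rV[R]_n -> R) (x : 'rV[R]_n).

Definition frac_plap_integrand (y : 'rV[R]_n) : R :=
  spowR (p - 1) (u x - u y) * enorm (x - y) `^ (- (n%:R + s * p)).

(* The value does not depend on [r]: it is the limit of twice the truncated
   integrals for every admissible [r]. *)
Definition frac_plap_value (r : R) : R :=
  2 * (\int[mu]_(y in [set y | r <= enorm (x - y)]) frac_plap_integrand y +
   2^-1 * \int[mu]_(y in [set y | 0 < enorm (x - y) < r])
      (frac_plap_integrand y + frac_plap_integrand (x + x - y))).

Hypothesis p1 : 1 < p.
Hypothesis mu_ : measurable_fun [set: 'rV[R]_n] u.

Lemma frac_plap_truncE eps : frac_plap_trunc s p u x eps =
  (\int[mu]_(y in [set y | (eps <= enorm (x - y))%R])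
    (frac_plap_integrand y)%:E)%E.
Proof.
apply: eq_integral => y _; congr EFin.
by rewrite /frac_plap_integrand spowRE ?powRN// gt_eqF// subr_gt0.
Qed.

Lemma measurable_frac_plap_integrand :
  measurable_fun [set: 'rV[R]_n] frac_plap_integrand.
Proof.
apply: measurable_funM; last first.
  exact: (measurableT_comp (@measurable_powR R _) (measurable_enorm_dist x)).
have mux : measurable_fun [set: 'rV[R]_n] (fun y => u x - u y).
  by apply: measurable_funB => //; exact: measurable_cst.
rewrite (_ : (fun y => _) = (fun y => `|u x - u y| `^ (p - 2) * (u x - u y))).
  apply: measurable_funM => //.
  apply: (measurableT_comp (@measurable_powR R (p - 2))).
  exact: measurableT_comp.
by apply/funext => y; rewrite spowRE// gt_eqF// subr_gt0.
Qed.

Lemma frac_plap_integrand_reflect y :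
  frac_plap_integrand y + frac_plap_integrand (x + x - y) =
  (spowR (p - 1) (u x - u y) + spowR (p - 1) (u x - u (x + x - y))) *
  enorm (x - y) `^ (- (n%:R + s * p)).
Proof. by rewrite /frac_plap_integrand enorm_reflect mulrDl. Qed.

Lemma is_frac_plap_value (b r A B : R) :
  0 < s * p -> 0 < b -> 0 < r -> 0 <= A -> 0 <= B ->
  (forall y, 0 < enorm (x - y) ->
    `|frac_plap_integrand y| <= A * enorm (x - y) `^ (- (n%:R + s * p))) ->
  (forall y, 0 < enorm (x - y) < r ->
    `|frac_plap_integrand y + frac_plap_integrand (x + x - y)| <=
    B * enorm (x - y) `^ (b - n%:R)) ->
  is_frac_plap s p u x (frac_plap_value r).
Proof.
move=> sp0 b0 r0 A0 B0 FA FB; rewrite /is_frac_plap.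
under eq_fun do rewrite frac_plap_truncE.
rewrite EFinM; apply: cvgeZl => //.
apply: (cvg_principal_value sp0 b0 r0 A0 B0) => //.
exact: measurable_frac_plap_integrand.
Qed.

End frac_plap_principal_value.

(** * Functions of class C^1 and C^2 *)

Section coordinate_mean_value.
Context {R : realType}.

Section fixed_dimension.
Variable n : nat.
Implicit Types (f : 'rV[R]_n -> R) (x y z h : 'rV[R]_n) (U : set 'rV[R]_n).
Local Notation e_ i := (delta_mx ord0 i : 'rV[R]_n).

Lemma is_derive_line f x i : derivable f x (e_ i) ->
  is_derive (0 : R) (1 : R) (fun s : R => f (x + s *: e_ i)) ('D_(e_ i) f x).
Proof.
move=> fx; set phi := fun _ => _.
have E : (fun h : R => h^-1 *: ((phi \o shift 0) (h *: 1) - phi 0)) =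
         (fun h : R => h^-1 *: ((f \o shift x) (h *: e_ i) - f x)).
  apply/funext => h /=; rewrite /phi scale0r !addr0 (addrC x).
  by rewrite [h *: 1]mulr1.
by split; rewrite /derivable /derive E.
Qed.

Variables (f : 'rV[R]_n -> R) (x0 : 'rV[R]_n) (r K : R).
Hypothesis fK : forall i y, `|y - x0| <= r ->
  exists2 D, is_derive (0 : R) (1 : R) (fun s : R => f (y + s *: e_ i)) D &
             `|D| <= K.

Let line_lipschitz_ge0 i y a : 0 <= a ->
  `|y - x0| <= r -> `|y + a *: e_ i - x0| <= r ->
  `|f (y + a *: e_ i) - f y| <= K * a.
Proof.
move=> a0 yr yar; pose phi s := f (y + s *: e_ i).
have box s : 0 <= s <= a -> `|y + s *: e_ i - x0| <= r.
  move=> /andP[s0 sa]; apply: norm_le_coord.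
    exact: le_trans yr.
  move=> j; have := le_trans (coord_le_norm _ j) yr.
  have := le_trans (coord_le_norm _ j) yar; rewrite !mxE eqxx/=.
  case: (j == i); last by rewrite !mulr0 addr0.
  by rewrite !mulr1 !ler_norml => /andP[? ?] /andP[? ?]; apply/andP; split; lra.
have dphi s : 0 <= s <= a ->
    is_derive s (1 : R) phi ('D_1 phi s) /\ `|'D_1 phi s| <= K.
  move=> /box /(fK i)[D dD DK].
  have ds : is_derive s (1 : R) phi D.
    have -> : phi = (fun t : R => f (y + s *: e_ i + t *: e_ i)) \o
        (fun t : R => t - s).
      apply/funext => t; rewrite /phi/= -addrA -scalerDl.
      by rewrite subrKC.
    have dg : is_derive s (1 : R) (fun t : R => t - s) 1.
      exact: is_derive_shift.
    rewrite -(subrr s) in dD.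
    have := @is_derive1_comp R _ (fun t : R => t - s) s D 1 dD dg.
    by rewrite mulr1.
  by rewrite (@derive_val _ _ _ _ _ _ _ ds).
have [||c cI] := @MVT_segment R phi (fun s => 'D_1 phi s) 0 a a0.
- move=> s; rewrite in_itv/= => /andP[? ?].
  by apply: (proj1 (dphi s _)); rewrite !ltW.
- apply: derivable_within_continuous => s; rewrite in_itv/= => /dphi[ds _].
  exact: ex_derive.
move: cI; rewrite in_itv/= => /dphi[_ cK].
rewrite subr0 {1 2}/phi scale0r addr0 => ->.
by rewrite normrM (ger0_norm a0) ler_wpM2r.
Qed.

Lemma line_lipschitz i y a :
  `|y - x0| <= r -> `|y + a *: e_ i - x0| <= r ->
  `|f (y + a *: e_ i) - f y| <= K * `|a|.
Proof.
move=> yr yar; have [a0|a0] := leP 0 a.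
  by rewrite (ger0_norm a0); exact: line_lipschitz_ge0.
have := @line_lipschitz_ge0 i (y + a *: e_ i) (- a).
rewrite scaleNr addrK => H; rewrite distrC (ltr0_norm a0); apply: H => //.
by rewrite oppr_ge0 ltW.
Qed.

(** Coordinates are changed one at a time. Sup-norm balls are boxes, so all intermediate points stay
    inside and the one-variable mean value theorem applies on each edge. *)
Lemma box_lipschitz y z : 0 <= K -> `|y - x0| <= r -> `|z - x0| <= r ->
  `|f z - f y| <= n%:R * K * `|z - y|.
Proof.
move=> K0 yr zr.
pose w k : 'rV[R]_n := \row_j (if (j < k)%N then z ord0 j else y ord0 j).
have wr k : `|w k - x0| <= r.
  apply: norm_le_coord => [|j]; first exact: le_trans yr.
  have := le_trans (coord_le_norm _ j) yr.
  have := le_trans (coord_le_norm _ j) zr.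
  by rewrite !mxE; case: ifP.
suff H k : (k <= n)%N -> `|f (w k) - f y| <= k%:R * K * `|z - y|.
  have -> : z = w n by apply/rowP => j; rewrite mxE ltn_ord.
  by rewrite (le_trans (H n _))// (_ : w n = z)//; apply/rowP => j;
    rewrite mxE ltn_ord.
elim: k => [_|k ih kn].
  rewrite (_ : w 0%N = y) ?subrr ?normr0 ?mul0r//.
  by apply/rowP => j; rewrite mxE.
pose i := Ordinal kn.
have wS : w k.+1 = w k + (z ord0 i - y ord0 i) *: e_ i.
  apply/rowP => j; rewrite !mxE eqxx/= ltnS leq_eqVlt.
  have [->|ji] := eqVneq j i; first by rewrite eqxx/= ltnn mulr1 subrKC.
  have -> : (nat_of_ord j == k) = false.
    by apply: contra_neqF ji => /eqP jk; exact: val_inj.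
  by rewrite /= mulr0 addr0.
rewrite -natr1 2!mulrDl mul1r -[f _ - f _](subrKA (f (w k))) [leRHS]addrC.
apply: le_trans (ler_normD _ _) _; apply: lerD; last exact/ih/ltnW.
have := wr k.+1; rewrite wS => wr'.
apply: le_trans (line_lipschitz (wr k) wr') _.
rewrite ler_wpM2l//; have := coord_le_norm (z - y) i.
by rewrite !mxE.
Qed.

End fixed_dimension.

(** Near [x0] the partial derivatives are within 1 of their values there, hence bounded by [K]. *)
Lemma Ck1_locally_lipschitz n (U : set 'rV[R]_n) (f : 'rV[R]_n -> R)
    (x0 : 'rV[R]_n) :
  nbhs x0 U -> Ck 1 U f -> exists2 L : R, 0 <= L &
    \forall e \near 0^'+, forall y z,
      `|y - x0| <= e -> `|z - x0| <= e -> `|f z - f y| <= L * `|z - y|.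
Proof.
move=> x0U [_ fC].
pose K : R := \sum_(i < n) (`|'D_(delta_mx ord0 i) f x0| + 1).
have Ki i : `|'D_(delta_mx ord0 i) f x0| + 1 <= K.
  by rewrite /K (bigD1 i)//= lerDl sumr_ge0// => j _; rewrite addr_ge0.
have K0 : 0 <= K by apply: sumr_ge0 => i _; rewrite addr_ge0.
exists (n%:R * K); first by rewrite mulr_ge0.
have Ux0 : U x0 by exact: nbhs_singleton.
have : \forall y \near x0, U y /\
    forall i, `|'D_(delta_mx ord0 i) f y| <= K.
  apply: filterI => //.
  apply: (@filter_forall _ _ _ (nbhs (x0 : 'rV[R]_n))) => i.
  have [_ [cDi _]] := fC i.
  have /(@cvgrPdist_le _ _ _ (nbhs (x0 : 'rV[R]_n))) := cDi x0 Ux0.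
  move=> /(_ 1 ltr01); apply: filterS => y.
  rewrite distrC => /(le_trans (lerB_dist _ _)); have := Ki i; lra.
move=> /nbhs_ballP[e0 /= e00 He0].
near=> e => y z ye ze.
have ee0 : e < e0 by near: e; exact: nbhs_right_lt.
apply: (@box_lipschitz n f x0 e K _ y z) => // i u ue.
have [Uu Du] : U u /\ forall i, `|'D_(delta_mx ord0 i) f u| <= K.
  apply: He0; rewrite mx_norm_ball /ball_/= distrC.
  exact: le_lt_trans ee0.
exists ('D_(delta_mx ord0 i) f u) => //.
by apply: is_derive_line; have [+ _] := fC i; exact.
Unshelve. all: by end_near. Qed.

(** Instead of a Taylor expansion, [psi y = f y + f (2 x - y)] is compared at [x + h] and [x]. Its
    partial derivatives are differences of those of [f] at reflected points, hence [O(|h|)] on the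
    box of radius [|h|], so that [psi] varies there by [O(|h|^2)]. *)
Lemma Ck2_second_difference n (U : set 'rV[R]_n) (f : 'rV[R]_n -> R)
    (x : 'rV[R]_n) :
  nbhs x U -> Ck 2 U f -> exists2 K : R, 0 <= K &
    \forall e \near 0^'+, forall h, `|h| <= e ->
      `|f (x + h) + f (x - h) - 2 * f x| <= K * `|h| ^+ 2.
Proof.
move=> xU [_ fC].
have /choice[L L0] : forall i, exists L : R, 0 <= L /\
    \forall e \near 0^'+, forall y z, `|y - x| <= e -> `|z - x| <= e ->
      `|'D_(delta_mx ord0 i) f z - 'D_(delta_mx ord0 i) f y| <= L * `|z - y|.
  move=> i; have [_ /(Ck1_locally_lipschitz xU)[L L0 LL]] := fC i.
  by exists L.
pose M := \sum_i L i.
have LM i : L i <= M.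
  by rewrite /M (bigD1 i)//= lerDl sumr_ge0// => j _; have [] := L0 j.
have M0 : 0 <= M by apply: sumr_ge0 => i _; have [] := L0 i.
exists (n%:R * (2 * M)); first by rewrite !mulr_ge0.
have lipD : \forall e \near 0^'+, forall i, forall y z,
    `|y - x| <= e -> `|z - x| <= e ->
    `|'D_(delta_mx ord0 i) f z - 'D_(delta_mx ord0 i) f y| <= M * `|z - y|.
  apply: filter_forall => i; have [_] := L0 i; apply: filterS => e H y z ye ze.
  by apply: le_trans (H y z ye ze) _; rewrite ler_wpM2r.
move: xU => /nbhs_ballP[e0 /= e00 He0].
have inU y e : `|y - x| <= e -> e < e0 -> U y.
  by move=> ye ee0; apply: He0; rewrite mx_norm_ball /ball_/= distrC;
    exact: le_lt_trans ee0.
near=> e => h he.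
have ee0 : e < e0 by near: e; exact: nbhs_right_lt.
have De : forall i y z, `|y - x| <= e -> `|z - x| <= e ->
    `|'D_(delta_mx ord0 i) f z - 'D_(delta_mx ord0 i) f y| <= M * `|z - y|.
  by near: e.
pose psi y := f y + f (x + x - y).
have -> : f (x + h) + f (x - h) - 2 * f x = psi (x + h) - psi x.
  by rewrite /psi addrK opprD addrA addrK mulr2n mulrDl mul1r.
have -> : n%:R * (2 * M) * `|h| ^+ 2 =
    n%:R * (2 * M * `|h|) * `|x + h - x|.
  by rewrite (addrAC x) subrr add0r; ring.
apply: (@box_lipschitz n psi x `|h|).
- move=> i y yh.
  have yh' : `|x + x - y - x| <= `|h|.
    by rewrite (addrAC _ (- y)) addrK distrC.
  have Uy : U y by apply: (inU _ e) => //; exact: le_trans he.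
  have Uy' : U (x + x - y) by apply: (inU _ e) => //; exact: le_trans he.
  have [dfU _] := fC i.
  have d1 := is_derive_line (dfU _ Uy).
  have d2 := is_derive_line (dfU _ Uy').
  exists ('D_(delta_mx ord0 i) f y - 'D_(delta_mx ord0 i) f (x + x - y)).
    have -> : (fun s : R => psi (y + s *: delta_mx ord0 i)) =
        (fun s : R => f (y + s *: delta_mx ord0 i)) +
        ((fun s : R => f (x + x - y + s *: delta_mx ord0 i)) \o -%R).
      apply/funext => s; rewrite -[RHS]/(f (y + s *: delta_mx ord0 i) +
        f (x + x - y + (- s) *: delta_mx ord0 i)) /psi.
      by rewrite opprD addrA scaleNr.
    apply: is_deriveD; first exact: d1.
    rewrite -[X in is_derive X _ _ _]oppr0 in d2.
    have dN : is_derive (0 : R) (1 : R) (-%R : R -> R) (-1).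
      exact: is_deriveNid.
    have := @is_derive1_comp R _ -%R 0 _ (-1) d2 dN.
    by rewrite mulrN1.
  apply: le_trans (De i _ _ _ _) _; [exact: le_trans he..|].
  rewrite -mulrA mulrCA ler_wpM2l//.
  rewrite opprB addrA; have -> : y + y - (x + x) = (y - x) + (y - x).
    by rewrite opprD addrACA.
  by apply: le_trans (ler_normD _ _) _; lra.
- by rewrite !mulr_ge0.
- by rewrite subrr normr0.
- by rewrite (addrAC x) subrr add0r.
Unshelve. all: by end_near. Qed.

End coordinate_mean_value.

(** * Distance to the boundary *)

Section boundary_distance.
Context {R : realType} (n : nat).
Implicit Types (A : set 'rV[R]_n) (x y z : 'rV[R]_n).

(** Otherwise the part of the segment in [A] would be nonempty and both open and closed in [[0, 1]],
    so it would contain the end point [y]. *)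
Lemma segment_meets_boundary A x y : open A -> A x -> ~ A y ->
  exists2 t : R, 0 <= t <= 1 & boundary A (x + t *: (y - x)).
Proof.
move=> oA Ax nAy; apply: contrapT => noB.
pose g (t : R) : 'rV[R]_n := x + t *: (y - x).
have cg : continuous g.
  move=> t; apply: (@continuousD _ _ _ (fun=> x) (fun t : R => t *: (y - x))).
    exact: cst_continuous.
  exact: scalel_continuous.
have AC t : 0 <= t <= 1 -> closure A (g t) -> A (g t).
  move=> t01 cAt; apply: contrapT => nAt; apply: noB; exists t => //.
  by split => // /interior_subset.
suff : `[0, 1]%classic `&` g @^-1` A = `[(0:R), 1]%classic.
  move=> /seteqP[_ /(_ 1)]; rewrite /= in_itv/= ler01 lexx => /(_ isT)[_].
  by rewrite /g scale1r subrKC.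
apply: (@segment_connected R 0 1).
- exists 0; split; first by rewrite /= in_itv/= lexx ler01.
  by rewrite /g/= scale0r addr0.
- exists (g @^-1` A) => //; apply: open_comp => // t _; exact: cg.
- exists (g @^-1` closure A).
    apply: closed_comp; last exact: closed_closure.
    by move=> t _; exact: cg.
  apply/seteqP; split => t [/= t01 At]; split => //.
    exact: subset_closure.
  by apply: AC => //; move: t01; rewrite in_itv.
Qed.

Lemma boundary_between A x y : open A -> A x -> ~ A y ->
  exists2 z, boundary A z & enorm (x - z) <= enorm (x - y).
Proof.
move=> oA Ax nAy; have [t /andP[t0 t1] tB] := segment_meets_boundary oA Ax nAy.
exists (x + t *: (y - x)) => //.
rewrite opprD addrA subrr add0r enormN enormZ ger0_norm// (enormB x).
by rewrite ler_piMl// enorm_ge0.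
Qed.

Lemma boundary_notin A x : open A -> boundary A x -> ~ A x.
Proof. by move=> oA [_] + Ax; rewrite (interior_id A).1. Qed.

Lemma compact_boundary A : open A -> bounded_set A -> compact (boundary A).
Proof.
move=> oA [M [_ AM]]; apply: bounded_closed_compact; last first.
  apply: closedI; first exact: closed_closure.
  exact/open_closedC/open_interior.
exists (M + 1); split; first exact: num_real.
move=> M' MM' x [cAx _] /=; rewrite (le_trans _ (ltW MM'))//.
rewrite leNgt; apply/negP => Mx.
have [y [Ay yx]] : A `&` ball x (`|x| - (M + 1)) !=set0.
  by apply: cAx; apply: nbhsx_ballx; rewrite subr_gt0.
have := AM (M + 1); rewrite ltrDl ltr01 => /(_ isT y Ay) /= yM.
move: yx; rewrite mx_norm_ball /ball_/= => yx.
by have := lerB_dist x y; lra.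
Qed.

End boundary_distance.

(** * Nearest boundary points and exterior cubes *)

Section bounded_open_set.
Context {R : realType} (n : nat) (A : set 'rV[R]_n).
Hypothesis n0 : (0 < n)%N.
Hypotheses (A0 : A !=set0) (oA : open A) (bA : bounded_set A).
Implicit Types (x y z : 'rV[R]_n).

Lemma boundary_neq0 : boundary A !=set0.
Proof.
have [x Ax] := A0; case: bA => M [_ AM].
have [i _] : exists i : 'I_n, true by exists (Ordinal n0).
pose y : 'rV[R]_n := const_mx (`|M| + 2).
have nAy : ~ A y.
  move=> /(AM (`|M| + 1) _ y)/=.
  have := coord_le_norm y i; rewrite mxE ger0_norm ?addr_ge0// => h.
  by have := ler_norm M => ? /(_ _)/(le_trans h); lra.
have [z zB _] := boundary_between oA Ax nAy.
by exists z.
Qed.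

Lemma bdist_le x z : boundary A z -> bdist A x <= enorm (x - z).
Proof.
move=> zB; apply: ge_inf; last by exists z.
by exists 0 => _ [w _ <-]; exact: enorm_ge0.
Qed.

(** Compactness turns the infimum into a minimum; a nearest point then replaces any differentiation
    of the distance. *)
Lemma nearest_boundary x :
  exists2 z, boundary A z & bdist A x = enorm (x - z).
Proof.
have [] := @compact_EVT_min _ R (fun z => enorm (x - z)) (boundary A).
- exact: boundary_neq0.
- exact: compact_boundary.
- apply: continuous_subspaceT => z.
  apply: (@continuous_comp _ _ _ (fun y => x - y) (@enorm R n)).
    by apply: continuousB => //; exact: cst_continuous.
  exact: continuous_enorm.
move=> z /set_mem zB zmin; exists z => //.
apply/eqP; rewrite eq_le bdist_le//=; apply: lb_le_inf.
  by exists (enorm (x - z)); exists z.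
by move=> _ [w wB <-]; apply: zmin; rewrite inE.
Qed.

Lemma bdist_lipschitz x y : bdist A y <= bdist A x + enorm (x - y).
Proof.
have [z zB ->] := nearest_boundary x.
apply: le_trans (bdist_le y zB) _.
by rewrite [leRHS]addrC (enormB x y); exact: ler_enormB.
Qed.

Lemma bdist_gt0 x : A x -> 0 < bdist A x.
Proof.
move=> Ax; have [z zB ->] := nearest_boundary x.
rewrite lt_def enorm_ge0 andbT enorm_eq0 subr_eq0.
by apply/negP => /eqP xz; apply: (boundary_notin oA zB); rewrite -xz.
Qed.

Lemma bdist_ball x y : A x -> enorm (x - y) < bdist A x -> A y.
Proof.
move=> Ax xy; apply: contrapT => nAy.
have [z zB zxy] := boundary_between oA Ax nAy.
by have := bdist_le x zB; lra.
Qed.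

(* Near a boundary point the set lies on one side of a Lipschitz graph, so going
   a distance [t] across the graph leaves room for a cube of size comparable to
   [t]; compactness of the boundary makes the ratio uniform. *)
Lemma uniform_exterior_cubes : smooth_boundary A ->
  exists2 k : R, 0 < k <= 1 & forall z t, boundary A z -> 0 < t < k ->
    exists2 c, `|c - z| <= t & forall y, `|y - c| <= k * t -> ~ A y.
Proof.
move=> sA.
(* The claim at one boundary point. Compactness is used in its near-covering form: [P] proved for
   all [z] near each [z0] and all small [k] holds on the whole boundary for some small [k]. *)
pose P (k : R) z := boundary A z -> forall t, 0 < t < k ->
    exists2 c, `|c - z| <= t & forall y, `|y - c| <= k * t -> ~ A y.
suff : \forall k \near 0^'+, boundary A `<=` P k.
  move=> H; near (0 : R)^'+ => k.
  have Pk : boundary A `<=` P k by near: k.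
  exists k; last by move=> z t zB; apply: Pk.
  apply/andP; split; first by near: k; exact: nbhs_right_gt.
  by near: k; exact: nbhs_right_le.
have /compact_near_coveringP := compact_boundary oA bA.
apply=> z0 z0B; have [rho [i [b [g [rho0 sg gA]]]]] := sA z0 z0B.
have [L L0 Lg] := @Ck1_locally_lipschitz R n.-1 setT g (col' i z0)
  filterT (sg 1%N).
have [e [e0 ge]] : exists e, 0 < e /\
    forall u v, `|u - col' i z0| <= e -> `|v - col' i z0| <= e ->
      `|g v - g u| <= L * `|v - u|.
  near (0 : R)^'+ => e; exists e; split; last by near: e.
  by near: e; exact: nbhs_right_gt.
pose N : R := n%:R + 1; have N0 : 0 < N by rewrite ltr_wpDl.
(* All points in play are within [3 eta] of [z0] in each coordinate: [eta] for [z], then [t < eta]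
   across the graph and [k t <= t] in the cube. They stay where the graph description and the
   Lipschitz bound hold. *)
pose eta := Num.min (e / 3) (rho / (4 * N)).
have eta0 : 0 < eta by rewrite lt_min !divr_gt0// mulr_gt0.
exists ([set z | `|z0 - z| <= eta], [set k | 0 < k < Num.min eta (L + 1)^-1]).
  split => /=; first exact: near_norm.
  near=> k; apply/andP; split; first by near: k; exact: nbhs_right_gt.
  near: k; apply: nbhs_right_lt; rewrite lt_min eta0 invr_gt0.
  by rewrite ltr_wpDl.
move=> [z k] /= [zz0 /andP[k0]]; rewrite lt_min => /andP[keta kL].
move=> zB t /andP[t0 tk].
have etae : eta <= e / 3 by rewrite ge_min lexx.
have etar : eta <= rho / (4 * N) by rewrite ge_min lexx orbT.
have k1 : k < 1.
  by apply: lt_le_trans kL _; rewrite invf_le1 ?lerDr// ltr_wpDl.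
have kt : k * t <= t by rewrite ler_piMl// ltW.
pose sgn : R := (-1) ^+ b.
have sgn1 : `|sgn| = 1 by rewrite normrX normrN1 expr1n.
have sgn2 : sgn * sgn = 1 by rewrite -expr2 sqrr_sign.
(* The centre lies at distance [t] from [z] along the [i]-th axis, away from the side of the graph
   on which [A] lies. *)
exists (z - (sgn * t) *: delta_mx ord0 i).
  apply: norm_le_coord => [|j]; first exact: ltW.
  rewrite !mxE addrAC subrr add0r normrN !normrM sgn1 mul1r.
  rewrite (gtr0_norm t0) eqxx/=; case: (j == i).
    by rewrite normr1 mulr1.
  by rewrite normr0 mulr0 ltW.
move=> y ycube.
have yc j : `|y ord0 j - (z ord0 j - sgn * t * (j == i)%:R)| <= k * t.
  apply: le_trans ycube; have := coord_le_norm
    (y - (z - (sgn * t) *: delta_mx ord0 i)) j.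
  by rewrite !mxE eqxx.
have zz0j j : `|z ord0 j - z0 ord0 j| <= eta.
  by have := le_trans (coord_le_norm _ j) zz0; rewrite !mxE distrC.
have yz0j j : `|y ord0 j - z0 ord0 j| <= 3 * eta.
  have tj : `|sgn * t * (j == i)%:R| <= t.
    rewrite !normrM sgn1 mul1r gtr0_norm//.
    by case: (j == i); rewrite ?normr1 ?mulr1// normr0 mulr0 ltW.
  move: (yc j) (zz0j j) tj; rewrite !ler_norml.
  by move=> /andP[? ?] /andP[? ?] /andP[? ?]; apply/andP; split; lra.
have in_rho (w : 'rV[R]_n) : (forall j, `|w ord0 j - z0 ord0 j| <= 3 * eta) ->
    enorm (w - z0) < rho.
  move=> wj; apply: (@le_lt_trans _ _ (n%:R * (3 * eta))).
    apply: enorm_le_coord => [|j]; first by lra.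
    by have := wj j; rewrite !mxE.
  have : eta * (4 * N) <= rho by rewrite -ler_pdivlMr// mulr_gt0.
  have : 0 <= n%:R :> R by [].
  by rewrite /N; nra.
have zg : sgn * z ord0 i <= g (col' i z).
  rewrite leNgt; apply/negP => H; apply: (boundary_notin oA zB).
  apply/(gA z) => //; apply: in_rho => j.
  by apply: le_trans (zz0j j) _; lra.
have gyz : `|g (col' i z) - g (col' i y)| <= L * (k * t).
  apply: (le_trans (ge _ _ _ _)).
  - apply: norm_le_coord => [|j]; first exact: ltW.
    rewrite !mxE; apply: le_trans (yz0j _) _; lra.
  - apply: norm_le_coord => [|j]; first exact: ltW.
    rewrite !mxE; apply: le_trans (zz0j _) _; lra.
  rewrite ler_wpM2l//; apply: norm_le_coord => [|j].
    by rewrite mulr_ge0 ?ltW.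
  rewrite !mxE distrC; have := yc (lift i j).
  by rewrite [_ == i]eq_sym (negPf (neq_lift _ _)) mulr0 subr0.
move=> /(gA y (in_rho y yz0j)); rewrite -/sgn => gy.
have := yc i; rewrite eqxx mulr1 => yci.
(* In the cube the signed coordinate drops by at least [(1 - k) t], while [g] drops by at most
   [L k t]. As [k (L + 1) <= 1], the point [y] cannot be strictly on the side of [A]. *)
have : sgn * y ord0 i <= sgn * z ord0 i - t + k * t.
  have : `|sgn * (y ord0 i - (z ord0 i - sgn * t))| <= k * t.
    by rewrite normrM sgn1 mul1r.
  have -> : sgn * (y ord0 i - (z ord0 i - sgn * t)) =
      sgn * y ord0 i - sgn * z ord0 i + sgn * sgn * t by ring.
  by rewrite sgn2 mul1r ler_norml => /andP[_]; lra.
have kL1 : k * (L + 1) <= 1.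
  by rewrite -ler_pdivlMr ?ltr_wpDl// mul1r ltW.
have : k * (L + 1) * t <= t by rewrite ler_piMl// ltW.
move: gyz; rewrite ler_norml => /andP[_ ?] ?.
by lra.
Unshelve. all: by end_near. Qed.

End bounded_open_set.

(** * Small powers of the distance *)

Section distance_powers.
Context {R : realType}.

Lemma powR_le_scaled (b d e : R) : 0 <= b <= 1 -> 0 < d -> 0 <= e ->
  e `^ b <= d `^ b * (1 + b * (e / d - 1)).
Proof.
move=> b01 d0 e0; have {1}-> : e = d * (e / d) by rewrite mulrC divfK ?gt_eqF.
rewrite powRM ?divr_ge0// ?(ltW d0)// ler_wpM2l ?powR_ge0//.
by apply: powR_le_bernoulli => //; rewrite divr_ge0// ltW.
Qed.

(** Bernoulli at [e / d] bounds one difference and at [d / e] the other; [t <= 1 / 2] gives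
    [e >= d / 2], so [d / e - 1 <= 2 t], whence the factor 2. *)
Lemma norm_powRB_le (b d e t : R) : 0 <= b <= 1 -> 0 < d -> 0 <= t <= 2^-1 ->
  `|e - d| <= t * d -> `|d `^ b - e `^ b| <= 2 * (b * d `^ b) * t.
Proof.
move=> b01 d0 t01; rewrite ler_norml => /andP[h1 h2].
have td : t * d <= 2^-1 * d by rewrite ler_pM2r//; lra.
have e0 : 0 < e by lra.
have db := powR_ge0 d b; have eb := powR_ge0 e b.
have bt0 : 0 <= b * t by rewrite mulr_ge0; lra.
have := mulr_ge0 bt0 db => btd.
rewrite ler_norml; apply/andP; split.
  have := @powR_le_scaled b d e b01 d0 (ltW e0).
  have : e / d - 1 <= t by rewrite lerBlDr ler_pdivrMr// mulrDl mul1r; lra.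
  move=> /(@ler_wpM2l R b); have /andP[-> _] := b01 => /(_ isT) h.
  have := @ler_wpM2l _ _ db _ _ h; nra.
have [de|ed] := leP d e.
  have : d `^ b <= e `^ b by rewrite ge0_ler_powR ?nnegrE; lra.
  by nra.
have := @powR_le_scaled b e d b01 e0 (ltW d0).
have h : d / e - 1 <= 2 * t by rewrite lerBlDr ler_pdivrMr//; nra.
have ed' : e `^ b <= d `^ b by rewrite ge0_ler_powR ?nnegrE; lra.
have {}h : b * (d / e - 1) <= b * (2 * t) by rewrite ler_wpM2l//; lra.
have := @ler_wpM2l _ _ eb _ _ h.
have : e `^ b * (b * (2 * t)) <= d `^ b * (b * (2 * t)).
  by rewrite ler_wpM2r// mulrCA mulr_ge0.
by nra.
Qed.

(* Convexity in the exponent turns the smallness of [b] into a factor [b / b1]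
   in front of a fixed power. *)
Lemma powRB1_le (b b1 t : R) : 0 < b <= b1 -> 2^-1 <= t ->
  (1 + t) `^ b - 1 <= b / b1 * (3 * t) `^ b1.
Proof.
move=> /andP[b0 bb1] t2; have b10 : 0 < b1 by lra.
have -> : (1 + t) `^ b = ((1 + t) `^ b1) `^ (b / b1).
  by rewrite -powRrM mulrC divfK// gt_eqF.
have bb : 0 <= b / b1 <= 1.
  by rewrite divr_ge0 ?(ltW b0) ?(ltW b10)// ler_pdivrMr// mul1r.
have := @powR_le_bernoulli R _ ((1 + t) `^ b1) bb (powR_ge0 _ _).
have : (1 + t) `^ b1 <= (3 * t) `^ b1 by rewrite ge0_ler_powR ?nnegrE; lra.
have /andP[+ _] := bb.
by set X := _ `^ b1; set Y := (3 * t) `^ b1; nra.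
Qed.

(** A point [z] nearest to [x] remains a competitor for [x + h] and [x - h]. With [w = x - z],
    Bernoulli with exponent [b / 2] is applied to the squares of [|w + h|] and [|w - h|], and the
    parallelogram law cancels the term linear in [h]. *)
Lemma bdist_powR_second_difference n (A : set 'rV[R]_n) (b : R) x h :
  (0 < n)%N -> A !=set0 -> open A -> bounded_set A -> 0 <= b <= 1 -> A x ->
  bdist A (x + h) `^ b + bdist A (x - h) `^ b - 2 * bdist A x `^ b <=
  b * bdist A x `^ b * (enorm h / bdist A x) ^+ 2.
Proof.
have ar (u v D X Y : R) :
    u <= D * (1 + b / 2 * (X - 1)) -> v <= D * (1 + b / 2 * (Y - 1)) ->
    u + v - 2 * D <= b * D * ((X + Y) / 2 - 1) by lra.
move=> n0 A0 oA bA b01 Ax.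
have dx0 := bdist_gt0 n0 A0 oA bA Ax.
have [z zB dz] := nearest_boundary n0 A0 oA bA x.
set d := bdist A x in dx0 dz *; pose w := x - z.
have step k : bdist A (x + k) `^ b <=
    d `^ b * (1 + b / 2 * (enorm (w + k) ^+ 2 / d ^+ 2 - 1)).
  have le1 : bdist A (x + k) <= enorm (w + k).
    rewrite /w addrAC; apply: bdist_le => //.
  have ge0 : 0 <= bdist A (x + k).
    by have [z' _ ->] := nearest_boundary n0 A0 oA bA (x + k);
      exact: enorm_ge0.
  apply: (@le_trans _ _ (enorm (w + k) `^ b)).
    by rewrite ge0_ler_powR ?nnegrE ?enorm_ge0//; lra.
  have sq v : 0 <= v -> v `^ b = (v ^+ 2) `^ (b / 2).
    by move=> v0; rewrite -powR_mulrn// -powRrM mulrC divfK.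
  rewrite !sq ?enorm_ge0 ?(ltW dx0)//.
  apply: powR_le_scaled; rewrite ?exprn_gt0 ?exprn_ge0 ?enorm_ge0//.
  by lra.
have := step h; have := step (- h).
have := enorm_parallelogram w h; rewrite -/w in dz.
rewrite -dz => par s1 s2.
have e1 : (enorm h / d) ^+ 2 = (enorm (w + h) ^+ 2 / d ^+ 2 +
    enorm (w - h) ^+ 2 / d ^+ 2) / 2 - 1.
  by rewrite -mulrDl par expr_div_n; field; rewrite gt_eqF.
by rewrite e1; exact: ar.
Qed.

End distance_powers.

(** * The barrier *)

Section barrier_estimate.
Context {R : realType} (n : nat) (A : set 'rV[R]_n).
Hypothesis n0 : (0 < n)%N.
Hypotheses (A0 : A !=set0) (oA : open A) (bA : bounded_set A).
Variables (d0 beta M : R) (r : 'rV[R]_n -> R).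
Hypotheses (d00 : 0 < d0) (beta01 : 0 < beta <= 1).
Hypothesis rext : barrier_ext A d0 beta r.
Hypothesis rM : forall x, (A `\` collar A d0) x -> r x <= M.
Implicit Types (x y : 'rV[R]_n).
Local Notation d := (bdist A).
Local Notation u := (barrier A d0 beta r).

Ltac blra := have := d00; have := beta01; lra.

Lemma barrier_out y : ~ A y -> u y = 0.
Proof.
move=> nAy; rewrite /barrier !memNset//; first by case.
Qed.

Lemma barrier_collar y : A y -> d y < d0 -> u y = d y `^ beta.
Proof. by move=> Ay dy; rewrite /barrier mem_set. Qed.

Lemma barrier_core_le y : A y -> d0 <= d y -> u y <= M.
Proof.
move=> Ay dy; rewrite /barrier memNset; last by move=> [_]; rewrite ltNge dy.
by rewrite mem_set//; apply: rM; split => // -[_]; rewrite ltNge dy.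
Qed.

Lemma barrier_ge0 y : 0 <= u y.
Proof.
have [Ay|nAy] := pselect (A y); last by rewrite barrier_out.
by apply: ltW; have [+ _ _] := rext; exact.
Qed.

(** The core may be empty, in which case [M] may be negative; hence [|M|]. *)
Lemma barrier_le y : u y <= d0 `^ beta + `|M|.
Proof.
have := powR_ge0 d0 beta; have M0 := normr_ge0 M; have := ler_norm M.
have [Ay|nAy] := pselect (A y); last by rewrite barrier_out//; blra.
have [dy|dy] := leP d0 (d y); first by have := barrier_core_le Ay dy; blra.
rewrite barrier_collar//.
have : d y `^ beta <= d0 `^ beta.
  have := bdist_gt0 n0 A0 oA bA Ay => dy0.
  by rewrite ge0_ler_powR ?nnegrE//; blra.
by blra.
Qed.

Lemma measurable_barrier : measurable_fun [set: 'rV[R]_n] u.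
Proof.
apply: (measurable_zero_extension oA); last exact: barrier_ge0.
- by have [_ [+ _] _] := rext.
- exact: barrier_out.
Qed.

Section at_point.
Variable x : 'rV[R]_n.
Hypotheses (Ax : A x) (dx : d x <= d0 / 2).

Let dx0 : 0 < d x. Proof. exact: bdist_gt0. Qed.

Ltac plra := have := dx; have := dx0; blra.

Lemma bdist_near y : `|d y - d x| <= enorm (x - y).
Proof.
have := bdist_lipschitz n0 A0 oA bA x y.
have := bdist_lipschitz n0 A0 oA bA y x; rewrite (enormB y).
by move=> h1 h2; rewrite ler_norml; apply/andP; split; plra.
Qed.

(** The ball stays in the collar: [d y <= 3 d x / 2] and [d x <= d0 / 2]. *)
Lemma barrier_near y : enorm (x - y) < d x / 2 -> u y = d y `^ beta.
Proof.
move=> ty; have Ay : A y.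
  by apply: (bdist_ball oA Ax); plra.
apply: barrier_collar => //.
by have := bdist_near y; rewrite ler_norml => /andP[_]; plra.
Qed.

Lemma barrier_at : u x = d x `^ beta.
Proof. by apply: barrier_collar => //; plra. Qed.

Lemma barrier_near_lipschitz y : enorm (x - y) < d x / 2 ->
  `|u x - u y| <= 2 * (beta * d x `^ beta) * (enorm (x - y) / d x).
Proof.
move=> ty; rewrite barrier_at barrier_near//; apply: norm_powRB_le => //.
- by apply/andP; split; plra.
- rewrite divr_ge0 ?enorm_ge0 ?(ltW dx0)//= ler_pdivrMr//; plra.
- by rewrite divfK ?gt_eqF//; exact: bdist_near.
Qed.

Lemma barrier_near_semiconcave y : enorm (x - y) < d x / 2 ->
  - (beta * d x `^ beta * (enorm (x - y) / d x) ^+ 2) <=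
  (u x - u y) + (u x - u (x + x - y)).
Proof.
have ar (u1 u2 D T : R) : u1 + u2 - 2 * D <= T ->
  - T <= (D - u1) + (D - u2) by lra.
move=> ty; rewrite barrier_at !barrier_near ?enorm_reflect//.
have b01 : 0 <= beta <= 1 by apply/andP; split; plra.
have := bdist_powR_second_difference (y - x) n0 A0 oA bA b01 Ax.
have -> : x + (y - x) = y by rewrite subrKC.
have -> : x - (y - x) = x + x - y by rewrite opprB addrCA addrA addrAC.
by rewrite (enormB y); exact: ar.
Qed.

(** Purely qualitative, with [K] depending on [x]: the C^2 bound is used up to some radius [e], and
    beyond it the global bound [W] is absorbed by [2 W / e^2] times the squared distance. *)
Lemma barrier_second_difference : exists2 K, 0 <= K &
  forall y, enorm (x - y) < d x / 2 ->
    `|(u x - u y) + (u x - u (x + x - y))| <= K * enorm (x - y) ^+ 2.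
Proof.
have [_ C2 _] := rext.
have xA : nbhs x A by exact: open_nbhs_nbhs.
have [K K0 HK] := Ck2_second_difference xA C2.
have [e [e0 He]] : exists e, 0 < e /\ forall h : 'rV[R]_n, `|h| <= e ->
    `|u (x + h) + u (x - h) - 2 * u x| <= K * `|h| ^+ 2.
  near (0 : R)^'+ => e; exists e; split; last by near: e.
  by near: e; exact: nbhs_right_gt.
pose W := d0 `^ beta + `|M|.
have uW y : 0 <= u y <= W by rewrite barrier_ge0 barrier_le.
have W0 : 0 <= W by have /andP[? ?] := uW x; plra.
exists (K + 2 * W / e ^+ 2).
  by rewrite addr_ge0// divr_ge0 ?mulr_ge0 ?exprn_ge0 ?(ltW e0).
move=> y _; have t0 := enorm_ge0 (x - y).
have [te|te] := leP (enorm (x - y)) e.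
  have yt : `|y - x| <= enorm (x - y) by rewrite enormB norm_le_enorm.
  have := He (y - x) (le_trans yt te).
  have -> : x + (y - x) = y by rewrite subrKC.
  have -> : x - (y - x) = x + x - y by rewrite opprB addrCA addrA addrAC.
  rewrite -[in `|u y + _ - _|]normrN.
  have -> : - (u y + u (x + x - y) - 2 * u x) =
    (u x - u y) + (u x - u (x + x - y)) by plra.
  move=> h; apply: le_trans h _; rewrite mulrDl.
  apply: (@le_trans _ _ (K * enorm (x - y) ^+ 2)).
    by rewrite ler_wpM2l// lerXn2r ?nnegrE.
  rewrite lerDl mulr_ge0 ?exprn_ge0//.
  by rewrite divr_ge0 ?mulr_ge0 ?exprn_ge0 ?(ltW e0).
have : 2 * W <= 2 * W / e ^+ 2 * enorm (x - y) ^+ 2.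
  rewrite -mulrA ler_peMr ?mulr_ge0// mulrC ler_pdivlMr ?exprn_gt0// mul1r.
  by rewrite lerXn2r ?nnegrE ?(ltW e0)// ltW.
have : 0 <= K * enorm (x - y) ^+ 2 by rewrite mulr_ge0 ?exprn_ge0.
rewrite mulrDl; have /andP[? ?] := uW x; have /andP[? ?] := uW y.
have /andP[? ?] := uW (x + x - y).
by move=> ? ?; rewrite ler_norml; apply/andP; split; plra.
Unshelve. all: by end_near. Qed.

(** * The integrand at a point near the boundary *)

Section operator.
Variables (s p kappa K : R).
Hypotheses (p1 : 1 < p) (sp0 : 0 < s * p) (spkappa : s * p < kappa).
Hypothesis K0 : 0 <= K.
Hypothesis spowK : forall c t a b, 0 <= c -> 0 <= t <= 1 ->
  `|b| <= 2 * c * t -> - (c * t ^+ 2) <= a + b ->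
  - (K * c `^ (p - 1) * t `^ kappa) <= spowR (p - 1) a + spowR (p - 1) b.
Local Notation F := (frac_plap_integrand s p u x).
Local Notation q := (p - 1).

Let q0 : 0 < q. Proof. by rewrite subr_gt0. Qed.

Ltac olra := have := q0; plra.

Lemma barrier_integrand_le y : 0 < enorm (x - y) ->
  `|F y| <= (d0 `^ beta + `|M|) `^ q * enorm (x - y) `^ (- (n%:R + s * p)).
Proof.
move=> _; rewrite /frac_plap_integrand normrM.
rewrite (ger0_norm (powR_ge0 _ _)) ler_wpM2r ?powR_ge0//.
rewrite norm_spowR// ge0_ler_powR ?nnegrE//; first exact: ltW.
  by rewrite addr_ge0 ?powR_ge0.
have := barrier_ge0 x; have := barrier_ge0 y.
have := barrier_le x; have := barrier_le y.
by move=> ? ? ? ?; rewrite ler_norml; apply/andP; split; olra.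
Qed.

Let powR_shift (t : R) : 0 < t ->
  t `^ kappa * t `^ (- (n%:R + s * p)) = t `^ (kappa - s * p - n%:R).
Proof.
move=> t0; rewrite -powRD; last by rewrite (gt_eqF t0) implybT.
by congr powR; ring.
Qed.

(** The hypothesis [spowK] with [c = beta d(x)^beta] and [t = |x - y| / d(x)]; this value of [c] is
    the source of the factor [beta^(p - 1)]. *)
Lemma barrier_integrand_near_ge y : 0 < enorm (x - y) < d x / 2 ->
  - (K * (beta * d x `^ beta) `^ q * (d x)^-1 `^ kappa *
     enorm (x - y) `^ (kappa - s * p - n%:R)) <= F y + F (x + x - y).
Proof.
move=> /andP[t0 ty]; rewrite frac_plap_integrand_reflect -powR_shift//.
rewrite mulrA -mulNr ler_wpM2r ?powR_ge0//.
apply: le_trans; last first.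
  apply: (@spowK (beta * d x `^ beta) (enorm (x - y) / d x)).
  - by rewrite mulr_ge0 ?powR_ge0; olra.
  - rewrite divr_ge0 ?enorm_ge0 ?(ltW dx0)//= ler_pdivrMr//; olra.
  - rewrite -enorm_reflect barrier_near_lipschitz// enorm_reflect//.
  - exact: barrier_near_semiconcave.
have -> : (enorm (x - y) / d x) `^ kappa =
    (d x)^-1 `^ kappa * enorm (x - y) `^ kappa.
  by rewrite mulrC powRM ?invr_ge0 ?enorm_ge0 ?(ltW dx0).
by rewrite mulrA.
Qed.

(** The same inequality is used for the two increments and for their opposites, now with
    [t = |x - y|] and with [c] enlarged by the two-sided constant of the second difference. *)
Lemma barrier_integrand_near_le : d x <= 1 -> exists2 B, 0 <= B &
  forall y, 0 < enorm (x - y) < d x / 2 ->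
  `|F y + F (x + x - y)| <= B * enorm (x - y) `^ (kappa - s * p - n%:R).
Proof.
move=> dx1; have [K2 K20 HK2] := barrier_second_difference.
pose c := beta * d x `^ beta / d x + K2.
have c10 : 0 <= beta * d x `^ beta / d x.
  by rewrite divr_ge0 ?mulr_ge0 ?powR_ge0//; olra.
have c0 : 0 <= c by rewrite addr_ge0.
exists (K * c `^ q); first by rewrite mulr_ge0 ?powR_ge0.
move=> y /andP[t0 ty]; rewrite frac_plap_integrand_reflect -powR_shift//.
rewrite normrM (ger0_norm (powR_ge0 _ _)) mulrA ler_wpM2r ?powR_ge0//.
have t01 : 0 <= enorm (x - y) <= 1 by apply/andP; split; olra.
have hb : `|u x - u (x + x - y)| <= 2 * c * enorm (x - y).
  have := @barrier_near_lipschitz (x + x - y); rewrite enorm_reflect.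
  move=> /(_ ty) h; apply: le_trans h _.
  rewrite /c; have : 0 <= K2 * enorm (x - y) by rewrite mulr_ge0// enorm_ge0.
  by olra.
have := HK2 y ty; rewrite ler_norml => /andP[h1 h2].
have le2 : K2 * enorm (x - y) ^+ 2 <= c * enorm (x - y) ^+ 2.
  by rewrite ler_wpM2r ?exprn_ge0 ?enorm_ge0// /c lerDr.
rewrite ler_norml; apply/andP; split.
  by apply: spowK => //; olra.
have : - (K * c `^ q * enorm (x - y) `^ kappa) <=
    spowR q (- (u x - u y)) + spowR q (- (u x - u (x + x - y))).
  by apply: spowK => //; [rewrite normrN|olra].
by rewrite !spowRN; olra.
Qed.

Variables (b1 : R).
Hypotheses (b11 : 0 < b1 <= 1) (betab1 : beta <= b1).
Hypothesis b1q : b1 * q < s * p.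
Local Notation a1 := (s * p - b1 * q).

(** Outside [A] the integrand is nonnegative. For [y] in the collar, [u y - u x] grows at most like
    [|x - y|^b1], which takes [b1 (p - 1)] off the decay exponent [s p]. For [y] in the core the
    increment is at most [|M|], written with the same decay at the price of a power of [d0 / 2]. *)
Lemma barrier_integrand_far_ge y : d x / 2 <= enorm (x - y) ->
  - (((d x `^ beta * (beta / b1) * (3 / d x) `^ b1) `^ q +
     `|M| `^ q * (d0 / 2) `^ (- (b1 * q))) *
     enorm (x - y) `^ (- (n%:R + a1))) <= F y.
Proof.
have ar (e f g h : R) : e <= f -> f - g <= h -> g <= e / 2 -> e / 2 <= h.
  by lra.
move=> ty; have t0 : 0 < enorm (x - y) by olra.
set t := enorm (x - y) in ty t0 *.
set T1 := (_ * _ * _) `^ q; set T2 := `|M| `^ q * _.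
have T10 : 0 <= T1 by exact: powR_ge0.
have T20 : 0 <= T2 by rewrite mulr_ge0 ?powR_ge0.
have shift e : t `^ (e - (n%:R + a1)) = t `^ e * t `^ (- (n%:R + a1)).
  by rewrite powRD// (gt_eqF t0) implybT.
have FE : F y = spowR q (u x - u y) * t `^ (- (b1 * q)) *
    t `^ (- (n%:R + a1)).
  rewrite /frac_plap_integrand -/t -mulrA -shift; congr (_ * _ `^ _).
  by ring.
have tt := powR_ge0 t (- (n%:R + a1)).
rewrite FE -mulNr ler_wpM2r//.
have red T : 0 <= T -> - T <= spowR q (u x - u y) * t `^ (- (b1 * q)) ->
    T <= T1 + T2 ->
    - (T1 + T2) <= spowR q (u x - u y) * t `^ (- (b1 * q)).
  by move=> _ h1 h2; apply: le_trans h1; rewrite lerN2.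
have ux0 := barrier_ge0 x.
have [Ay|nAy] := pselect (A y); last first.
  apply: (red 0) => //; last exact: addr_ge0.
  rewrite oppr0 (barrier_out nAy) subr0 mulr_ge0 ?powR_ge0//.
  by rewrite spowR_ge0E// powR_ge0.
have base v : 0 <= v -> u y - u x <= v ->
    - (v `^ q * t `^ (- (b1 * q))) <=
    spowR q (u x - u y) * t `^ (- (b1 * q)).
  move=> v0 uv; rewrite -mulNr ler_wpM2r ?powR_ge0//.
  rewrite -(spowR_ge0E q0 v0) -spowRN; apply: ler_spowR => //.
  by rewrite -opprB lerN2.
have [dy|dy] := leP d0 (d y).
  have uyM := barrier_core_le Ay dy.
  apply: (red (`|M| `^ q * t `^ (- (b1 * q)))).
  - by rewrite mulr_ge0 ?powR_ge0.
  - apply: base => //; rewrite lerBlDr (le_trans uyM)//.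
    by rewrite (le_trans (ler_norm M))// lerDl.
  apply: (@le_trans _ _ T2); last by rewrite lerDr.
  rewrite ler_wpM2l ?powR_ge0// !powRN lef_pV2 ?posrE ?powR_gt0//; last first.
    by rewrite divr_gt0.
  have b1q0 : 0 <= b1 * q.
    by have /andP[/ltW b10 _] := b11; rewrite mulr_ge0// ltW.
  (* The distance to the boundary is 1-Lipschitz, at least [d0] at [y] and at most [d0 / 2] at
     [x]. *)
  have dt : d0 / 2 <= t.
    have h1 := le_trans (ler_norm _) (bdist_near y).
    exact: ar dy h1 dx.
  rewrite ge0_ler_powR ?nnegrE//; first by rewrite divr_ge0// ltW.
  exact: ltW.
apply: (red T1); [exact: T10| |by rewrite lerDl].
have b10 : 0 < b1 by have /andP[] := b11.
have beta0 : 0 < beta by have /andP[] := beta01.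
(* A bound for [u y - u x], arranged so that the powers of [t] cancel in [v^q t^(- b1 q)]. *)
pose v := d x `^ beta * (beta / b1) * (3 / d x) `^ b1 * t `^ b1.
have v0 : 0 <= v.
  by rewrite !mulr_ge0 ?powR_ge0 ?invr_ge0// ltW.
have -> : T1 = v `^ q * t `^ (- (b1 * q)).
  rewrite /v [in RHS]powRM ?powR_ge0//; last first.
    by rewrite !mulr_ge0 ?powR_ge0 ?invr_ge0// ltW.
  rewrite -/T1 -[(t `^ b1) `^ q]powRrM -mulrA -powRD; last first.
    by rewrite (gt_eqF t0) implybT.
  by rewrite subrr powRr0 mulr1.
apply: base => //.
rewrite barrier_collar// barrier_at.
have dy0 : 0 <= d y by apply: ltW; exact: bdist_gt0.
have dyt : d y <= d x * (1 + t / d x).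
  have := le_trans (ler_norm _) (bdist_near y); rewrite -/t.
  rewrite mulrDr mulr1 mulrCA mulfV ?gt_eqF// mulr1.
  by rewrite lerBlDl.
have tau : 2^-1 <= t / d x by rewrite ler_pdivlMr// mulrC.
have h1 : d y `^ beta <= d x `^ beta * (1 + t / d x) `^ beta.
  rewrite -powRM ?(ltW dx0)//; last first.
    by rewrite addr_ge0// divr_ge0// ltW.
  apply: ge0_ler_powR; rewrite ?nnegrE ?(ltW beta0)//.
  by rewrite mulr_ge0 ?addr_ge0 ?divr_ge0 ?(ltW dx0)// ltW.
have bb1 : 0 < beta <= b1 by rewrite beta0 betab1.
have h2 := powRB1_le bb1 tau.
have h3 : v = d x `^ beta * (beta / b1 * (3 * (t / d x)) `^ b1).
  rewrite /v -!mulrA; congr (_ * (_ * _)); congr (_ * _).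
  rewrite -powRM ?divr_ge0 ?(ltW dx0) ?(ltW t0)//.
  by congr powR; ring.
rewrite h3; apply: le_trans (ler_wpM2l (powR_ge0 _ _) h2).
by rewrite mulrBr mulr1 lerD2r.
Qed.

Variables (k CT CN : R).
Hypothesis k01 : 0 < k <= 1.
Hypothesis exterior : exists2 c, `|c - x| <= 2 * d x &
  forall y, `|y - c| <= k * d x -> ~ A y.

(** The gain is collected on a cube outside [A], where the barrier vanishes and the integrand is the
    full [u(x)^(p - 1)] times the kernel; the far and near errors are subtracted. *)
Lemma barrier_frac_plap : d x <= 1 ->
  \int[@lebesgue_rV R n]_(y in [set y | d x / 2 <= enorm (x - y)])
    enorm (x - y) `^ (- (n%:R + a1)) <= CT ->
  \int[@lebesgue_rV R n]_(y in [set y | 0 < enorm (x - y) < d x / 2])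
    enorm (x - y) `^ (kappa - s * p - n%:R) <= CN ->
  exists2 L, is_frac_plap s p u x L &
    2 * ((d x `^ beta) `^ q * (3 * n%:R * d x) `^ (- (n%:R + s * p)) *
           (2 * (k * d x)) ^+ n -
         ((d x `^ beta * (beta / b1) * (3 / d x) `^ b1) `^ q +
           `|M| `^ q * (d0 / 2) `^ (- (b1 * q))) * CT -
         2^-1 * (K * (beta * d x `^ beta) `^ q * (d x)^-1 `^ kappa * CN))
    <= L.
Proof.
move=> dx1 hCT hCN.
have [B B0 FB] := barrier_integrand_near_le dx1.
have rr0 : 0 < d x / 2 by rewrite divr_gt0.
have WW0 : 0 <= (d0 `^ beta + `|M|) `^ q by exact: powR_ge0.
have kk0 : 0 < kappa - s * p by rewrite subr_gt0.
exists (frac_plap_value s p u x (d x / 2)).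
  apply: (@is_frac_plap_value _ _ s p u x p1 measurable_barrier
    (kappa - s * p) (d x / 2) _ B sp0 kk0 rr0 WW0 B0) => //.
  exact: barrier_integrand_le.
have [c cx cA] := exterior.
(* Half-open, to match the sets whose volume is known as a product of side lengths. *)
pose box := [set y : 'rV[R]_n | forall i,
  y ord0 i \in `]c ord0 i - k * d x, c ord0 i + k * d x]].
have kd0 : 0 < k * d x by rewrite mulr_gt0//; case/andP: k01.
have boxc y : box y -> `|y - c| <= k * d x.
  move=> By; apply: norm_le_coord => [|i]; first exact: ltW.
  have := By i; rewrite in_itv/= !mxE => /andP[? ?].
  by rewrite ler_norml; apply/andP; split; olra.
have mbox : measurable box.
  apply: (@measurable_rect R n
    (fun i => [set` `]c ord0 i - k * d x, c ord0 i + k * d x]])) => i.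
  exact: measurable_itv.
have mubox : @lebesgue_rV R n box = ((2 * (k * d x)) ^+ n)%:E.
  rewrite lebesgue_rV_box; last by move=> i; olra.
  congr EFin; transitivity (\prod_(i < n) (2 * (k * d x))).
    by apply: eq_bigr => i _; ring.
  by rewrite prodr_const card_ord.
have boxfar : box `<=` [set y | d x / 2 <= enorm (x - y)].
  move=> y /boxc /cA nAy; rewrite /= leNgt; apply/negP => h; apply: nAy.
  by apply: (bdist_ball oA Ax); olra.
(* In the sup norm the distance is at most [2 d x + k d x <= 3 d x]; the factor [n] passes to the
   Euclidean norm. *)
have boxle y : box y -> enorm (x - y) <= 3 * n%:R * d x.
  move=> /boxc yc; apply: (@le_trans _ _ (n%:R * (3 * d x))); last by olra.
  apply: enorm_le_coord => [|i]; first by olra.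
  apply: le_trans (coord_le_norm _ _) _.
  rewrite -(subrKA c); apply: le_trans (ler_normD _ _) _.
  rewrite (distrC x c) (distrC c y).
  have : k * d x <= d x.
    by rewrite ger_pMl//; case/andP: k01.
  by olra.
have Flow y : box y -> (d x `^ beta) `^ q *
    (3 * n%:R * d x) `^ (- (n%:R + s * p)) <= F y.
  move=> By; have nAy := cA _ (boxc _ By).
  rewrite /frac_plap_integrand (barrier_out nAy) subr0 barrier_at.
  rewrite spowR_ge0E ?powR_ge0// ler_wpM2l ?powR_ge0//.
  have t0 : 0 < enorm (x - y) by apply: lt_le_trans (boxfar _ By).
  have h := boxle _ By.
  rewrite !powRN lef_pV2 ?posrE ?powR_gt0//; last exact: lt_le_trans h.
  rewrite ge0_ler_powR ?nnegrE ?(ltW t0)//.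
    by rewrite addr_ge0// ltW.
  by apply: le_trans h; exact: ltW.
rewrite /frac_plap_value ler_pM2l//.
have -> : (2 * (k * d x)) ^+ n = fine (@lebesgue_rV R n box).
  by rewrite mubox.
apply: (@principal_value_ge R n x F (s * p) a1 (kappa - s * p) (d x / 2) _
  ((d0 `^ beta + `|M|) `^ q) _ B) => //.
- by rewrite subr_gt0.
- by rewrite addr_ge0 ?mulr_ge0 ?powR_ge0.
- by rewrite !mulr_ge0 ?powR_ge0.
- exact: (measurable_frac_plap_integrand _ _ p1 measurable_barrier).
- exact: barrier_integrand_le.
- exact: barrier_integrand_near_ge.
- exact: barrier_integrand_far_ge.
- by rewrite mubox ltry.
- by rewrite mulr_ge0 ?powR_ge0.
Qed.

End operator.
End at_point.
End barrier_estimate.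

(** * Scaling and choice of the constants *)

Lemma barrier_scaling (R : realType) (n : nat)
    (d beta b1 q k S K kappa CT CN m : R) :
  0 < d -> 0 < beta -> 0 < b1 -> 0 < k -> 0 <= m ->
  (d `^ beta) `^ q * (3 * n%:R * d) `^ (- (n%:R + S)) * (2 * (k * d)) ^+ n -
    ((d `^ beta * (beta / b1) * (3 / d) `^ b1) `^ q + m) *
      (CT * (d / 2) `^ (- (S - b1 * q))) -
    2^-1 * (K * (beta * d `^ beta) `^ q * d^-1 `^ kappa *
      (CN * (d / 2) `^ (kappa - S))) =
  d `^ (beta * q - S) * ((3 * n%:R) `^ (- (n%:R + S)) * (2 * k) ^+ n -
    (3 `^ (b1 * q) * b1^-1 `^ q * 2^-1 `^ (- (S - b1 * q)) * CT +
     2^-1 * (K * CN * 2^-1 `^ (kappa - S))) * beta `^ q) -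
  m * 2^-1 `^ (- (S - b1 * q)) * CT * d `^ (- (S - b1 * q)).
Proof.
move=> d0 beta0 b10 k0 m0.
have dN0 : d != 0 by rewrite gt_eqF.
have d0' : 0 <= d by exact: ltW.
have di e : d^-1 `^ e = d `^ (- e).
  by rewrite -powR_inv1// -powRrM mulN1r.
have -> : (2 * (k * d)) ^+ n = (2 * k) ^+ n * d `^ n%:R.
  by rewrite powR_mulrn// mulrA exprMn.
rewrite (powRM (- (n%:R + S)) (_ : 0 <= 3 * n%:R) d0')//.
rewrite (powRM q (ltW beta0) (powR_ge0 d beta)).
rewrite (powRM q (_ : 0 <= d `^ beta * (beta / b1)))//; last first.
- exact: powR_ge0.
- by rewrite mulr_ge0 ?powR_ge0 ?divr_ge0// ltW.
rewrite (powRM q (powR_ge0 d beta) (_ : 0 <= beta / b1)); last first.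
  by rewrite divr_ge0 ?ltW.
rewrite (powRM q (ltW beta0) (_ : 0 <= b1^-1)); last first.
  by rewrite invr_ge0 ltW.
rewrite (powRM b1 (_ : 0 <= 3) (_ : 0 <= d^-1))//; last by rewrite invr_ge0.
rewrite (powRM q (powR_ge0 _ _) (powR_ge0 _ _)).
rewrite !(powRM _ d0' (_ : 0 <= 2^-1)) ?invr_ge0// -!powRrM !di.
(* One factorisation of the common power for each term: the exterior cube, the far part of the
   collar, the ball around [x]. Only the core term [m] scales differently, like [d^(b1 q - S)]. *)
have h1 : d `^ (beta * q - S) =
    d `^ (beta * q) * d `^ (- (n%:R + S)) * d `^ n%:R.
  rewrite -!powRD ?dN0 ?implybT//; congr powR; ring.
have h2 : d `^ (beta * q - S) =
    d `^ (beta * q) * d `^ (- (b1 * q)) * d `^ (- (S - b1 * q)).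
  rewrite -!powRD ?dN0 ?implybT//; congr powR; ring.
have h3 : d `^ (beta * q - S) =
    d `^ (beta * q) * d `^ (- kappa) * d `^ (kappa - S).
  rewrite -!powRD ?dN0 ?implybT//; congr powR; ring.
have expand (D X e1 e2 b w : R) :
  D * (X - (e1 + e2) * b) - w = D * X - D * e1 * b - D * e2 * b - w by ring.
by rewrite expand {1}h1 {1}h2 h3; ring.
Qed.

Theorem lemma3p2 (R : realType) (N : nat) (s p : R) (Omega : set 'rV[R]_N) :
  (2 <= N)%N -> 0 < s < 1 -> 2 / (2 - s) < p ->
  smooth_bounded_domain Omega ->
  forall delta0 M : R,
  0 < delta0 -> Ck 2 (collar Omega delta0) (bdist Omega) ->
  exists delta C beta0 : R,
    [/\ 0 < delta <= delta0, 0 < C, 0 < beta0 < s * p / (p - 1) &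
      forall beta : R, 0 < beta < beta0 ->
      forall r : 'rV[R]_N -> R,
        barrier_ext Omega delta0 beta r ->
        (forall x, (Omega `\` collar Omega delta0) x -> r x <= M) ->
      forall x, collar Omega delta x ->
        exists2 L : R,
          is_frac_plap s p (barrier Omega delta0 beta r) x L &
          - L <= - C * bdist Omega x `^ (beta * (p - 1) - s * p)].
Proof.
move=> N2 s01 ps [Om0 oOm _ bOm smOm] delta0 M delta00 _.
have N0 : (0 < N)%N by exact: ltnW.
have p1 : 1 < p.
  by apply: lt_trans ps; rewrite ltr_pdivlMr; lra.
have q0 : 0 < p - 1 by lra.
have sp0 : 0 < s * p by rewrite mulr_gt0; lra.
have [kappa [K [spkappa K0 spowK]]] := spowR_second_difference s01 ps.
have [k k01 ext] := uniform_exterior_cubes oOm bOm smOm.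
have k0 : 0 < k by case/andP: k01.
(* Half the critical exponent [s p / (p - 1)], capped at 1 so that the powers involved are
   concave. *)
pose b1 := Num.min 1 (s * p / (2 * (p - 1))).
have b10 : 0 < b1 by rewrite lt_min ltr01 divr_gt0// mulr_gt0.
have b11 : b1 <= 1 by rewrite ge_min lexx.
have b1le : b1 <= s * p / (2 * (p - 1)) by rewrite ge_min lexx orbT.
have b1q : b1 * (p - 1) < s * p.
  have : b1 * (2 * (p - 1)) <= s * p by rewrite -ler_pdivlMr// mulr_gt0.
  have : 0 < b1 * (p - 1) by rewrite mulr_gt0.
  by lra.
have a10 : 0 < s * p - b1 * (p - 1) by rewrite subr_gt0.
have kap0 : 0 < kappa - s * p by rewrite subr_gt0.
have [CT CT0 hCT] := @Rintegral_enorm_tail R N _ a10.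
have [CN CN0 hCN] := @Rintegral_enorm_near R N _ kap0.
pose c0 := (3 * N%:R) `^ (- (N%:R + s * p)) * (2 * k) ^+ N.
have c00 : 0 < c0.
  by rewrite mulr_gt0 ?powR_gt0 ?exprn_gt0 ?mulr_gt0// ltr0n.
pose E1 := 3 `^ (b1 * (p - 1)) * b1^-1 `^ (p - 1) *
    2^-1 `^ (- (s * p - b1 * (p - 1))) * CT +
  2^-1 * (K * CN * 2^-1 `^ (kappa - s * p)).
have E10 : 0 <= E1.
  by rewrite addr_ge0// !mulr_ge0 ?powR_ge0// invr_ge0.
pose m := `|M| `^ (p - 1) * (delta0 / 2) `^ (- (b1 * (p - 1))).
have m0 : 0 <= m by rewrite mulr_ge0 ?powR_ge0.
pose E2 := m * 2^-1 `^ (- (s * p - b1 * (p - 1))) * CT.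
have E20 : 0 <= E2 by rewrite !mulr_ge0 ?powR_ge0.
(* Two errors of at most [c0 / 4] leave [c0 / 2] of the exterior term; the factor 2 in the operator
   turns this into [C = c0]. *)
have small (E a : R) : 0 <= E -> 0 < a ->
    \forall e \near 0^'+, E * e `^ a <= c0 / 4.
  move=> E0 a0.
  have : E * e `^ a @[e --> 0^'+] --> (0 : R).
    rewrite -[X in _ --> X](mulr0 E).
    by apply: cvgM; [exact: cvg_cst|exact: powR_cvg0].
  move=> /cvgrPdist_le /(_ (c0 / 4)); rewrite divr_gt0// => /(_ isT).
  apply: filterS => e; rewrite sub0r normrN.
  by apply: le_trans; exact: ler_norm.
(* With [beta <= b1 / 2] the core term is smaller than the main one by a power of [d] of exponent at
   least [b1 (p - 1) / 2], so [delta] can be chosen independently of [beta]. *)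
have [beta0 [beta00 beta0le beta0E]] : exists beta0, [/\ 0 < beta0,
    beta0 <= b1 / 2 & E1 * beta0 `^ (p - 1) <= c0 / 4].
  near (0 : R)^'+ => e; exists e; split; near: e.
  - exact: nbhs_right_gt.
  - by apply: nbhs_right_le; rewrite divr_gt0.
  - exact: small.
(* The caps keep [x] away from the core, make powers of [d] decrease in the exponent, and give
   access to exterior cubes at scale [d]. *)
have [delta [deltapos deltale deltaE]] : exists delta, [/\ 0 < delta,
    [/\ delta <= delta0 / 2, delta <= 1 & delta <= k] &
    E2 * delta `^ (b1 * (p - 1) / 2) <= c0 / 4].
  near (0 : R)^'+ => e; exists e; split; last 1 first.
  - by near: e; apply: small => //; rewrite divr_gt0// mulr_gt0.
  - by near: e; exact: nbhs_right_gt.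
  - split; near: e; apply: nbhs_right_le => //.
    by rewrite divr_gt0.
have [dle dle1 dlek] := deltale.
exists delta, c0, beta0; split => //.
- by rewrite deltapos/=; lra.
- rewrite beta00/=; apply: (@lt_le_trans _ _ b1); first by lra.
  apply: (le_trans b1le); rewrite ler_pM2l// lef_pV2 ?posrE ?mulr_gt0//.
  by lra.
move=> beta /andP[betapos betalt] r rext rM x [Omx dxd].
have dx0 := bdist_gt0 N0 Om0 oOm bOm Omx.
set d := bdist Omega x in dxd dx0 *.
have ddelta : d <= delta0 / 2 by exact: le_trans (ltW dxd) dle.
have dk : d < k by exact: lt_le_trans dxd dlek.
have d1 : d <= 1 by exact: le_trans (ltW dxd) dle1.
have beta01 : 0 < beta <= 1.
  rewrite betapos/=; apply: le_trans (ltW betalt) _.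
  by apply: (le_trans beta0le); lra.
have betab1 : beta <= b1.
  by apply: le_trans (ltW betalt) _; apply: (le_trans beta0le); lra.
have b1' : 0 < b1 <= 1 by rewrite b10.
have exterior : exists2 c, `|c - x| <= 2 * d &
    forall y, `|y - c| <= k * d -> ~ Omega y.
  have [z zB dz] := nearest_boundary N0 Om0 oOm bOm x.
  have dk' : 0 < d < k by rewrite dx0.
  have [c cz cP] := ext z d zB dk'; exists c => //.
  rewrite -(subrKA z); apply: le_trans (ler_normD _ _) _.
  rewrite (_ : 2 * d = d + d); last by ring.
  apply: lerD => //.
  by rewrite /d dz enormB; exact: norm_le_enorm.
have dd2 : 0 < d / 2 by rewrite divr_gt0.
have [_ hT] := hCT x _ dd2.
have [_ hN] := hCN x _ dd2.
have [L Lplap Lge] := barrier_frac_plap N0 Om0 oOm bOm delta00 beta01 rext rM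
  Omx ddelta p1 sp0 spkappa K0 spowK b1' betab1 b1q k01 exterior d1 hT hN.
exists L => //; rewrite mulNr lerN2; apply: le_trans Lge.
rewrite -/d -/m barrier_scaling// -/c0 -/E1 -/E2.
set D := d `^ (beta * (p - 1) - s * p).
have D0 : 0 <= D by exact: powR_ge0.
have h1 : E1 * beta `^ (p - 1) <= c0 / 4.
  apply: le_trans beta0E; rewrite ler_wpM2l// ge0_ler_powR ?nnegrE ?ltW//.
have h2 : E2 * d `^ (- (s * p - b1 * (p - 1))) <= D * (c0 / 4).
  have -> : d `^ (- (s * p - b1 * (p - 1))) = D * d `^ ((b1 - beta) * (p - 1)).
    rewrite /D -powRD; last by rewrite (gt_eqF dx0) implybT.
    by congr powR; ring.
  rewrite mulrCA ler_wpM2l//; apply: le_trans deltaE; rewrite ler_wpM2l//.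
  apply: (@le_trans _ _ (d `^ (b1 * (p - 1) / 2))).
    apply: ger_powR; first by rewrite dx0.
    rewrite mulrAC ler_pM2r//.
    have := ltW betalt => h; have := le_trans h beta0le; lra.
  by rewrite ge0_ler_powR ?nnegrE ?divr_ge0 ?mulr_ge0 ?(ltW dx0)// ltW.
have := ler_wpM2l D0 h1; move: h2.
move: (E2 * _) (E1 * _) => e2 e1 h2 h3.
have ar : c0 * D <= 2 * (D * (c0 - e1) - e2).
  have -> : D * (c0 - e1) = D * c0 - D * e1 by ring.
  by rewrite [c0 * D]mulrC; move: h2 h3; move: (D * e1) => e3; lra.
exact: ar.
Unshelve. all: by end_near. Qed.
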